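(* Let $\epsilon=1/4$ and, for $j\ge1$, $m_j=2^{cj^2}-1$. Let $b_1=1$, $c\ge0$, and, for $l\ge2$, $b_l=2^{\left(c\sum_{j=1}^{l-1}b_j\right)^2}$. For $l\ge1$ and $j\in\left\{\sum_{k=1}^{l-1}b_k+1,\ldots,\sum_{k=1}^{l}b_k\right\}$ set $\lambda_j=\dfrac{(3/4)^{l-1}}{4b_l}$. If $c\ge8$, then the associated Bramson-Kalikow model $p$ (with parameters $\epsilon,(\lambda_j)_{j\ge1},(m_j)_{j\ge1}$) has multiple $p$-measures, i.e. there exist at least two distinct $p$-measures.
   Context: Let $A=\{-1,+1\}$ and $\mathcal X=A^{\mathbb Z_-}$, where $\mathbb Z_-=\{\ldots,-2,-1,0\}$, with the product topology (compact metrizable) and Borel $\sigma$-algebra. $\mathcal C(\mathcal X)$ is the space of continuous real functions on $\mathcal X$ with the sup norm. For $a\in A$ and $x\in\mathcal X$, the concatenation $ax\in\mathcal X$ is defined by $(ax)_0=a$ and $(ax)_{-i-1}=x_{-i}$ for $i\ge0$. The shift $T:\mathcal X\to\mathcal X$ is $(Tx)_i=x_{i-1}$. Let $\mathcal G$ be the set of $g\in\mathcal C(\mathcal X)$ with $g(x)\in(0,1)$ and $\sum_{a\in A}g(ax)=1$ for all $x\in\mathcal X$. For $g\in\mathcal G$, a $g$-measure is a $T$-invariant Borel probability measure $\mu$ on $\mathcal X$ such that $\mu(\{x\in\mathcal X: x_0=a\}\mid T^{-1}\mathcal B)(x)=g(ax_{-\infty}^{-1})$ for $a\in A$ ($\mu$-a.s.),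 where $\mathcal B$ is the Borel $\sigma$-algebra and $ax_{-\infty}^{-1}$ is the sequence $x$ with its coordinate at index $0$ replaced by $a$; equivalently $\int f\,d\mu=\int\sum_{a\in A}g(ax)f(ax)\,d\mu(x)$ for all $f\in\mathcal C(\mathcal X)$. Given $\epsilon\in(0,1/2)$, positive numbers $(\lambda_j)_{j\ge1}$ with $\sum_j\lambda_j=1$, and an increasing sequence $(m_j)_{j\ge1}$ of positive odd numbers, the Bramson-Kalikow (BK) model is the function $p\in\mathcal G$ given by $p(x)=\sum_{j=1}^\infty\lambda_j\,p_{[m_j]}(x)$, where $$p_{[m_j]}(x)=\mathbf 1\Big\{x_0\sum_{l=1}^{m_j}x_{-l}>0\Big\}(1-\epsilon)+\mathbf 1\Big\{x_0\sum_{l=1}^{m_j}x_{-l}<0\Big\}\epsilon .$$ An empty sum (such as $\sum_{k=1}^{0}b_k$) equals $0$. *)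

(* Defs.v *)
From HB Require Import structures.
From mathcomp Require Import all_boot all_order all_algebra.
From mathcomp Require Import all_classical all_reals all_analysis.

Set Implicit Arguments.
Unset Strict Implicit.
Unset Printing Implicit Defensive.

Import Order.TTheory GRing.Theory Num.Theory.
Import numFieldNormedType.Exports.

Local Open Scope classical_set_scope.
Local Open Scope ring_scope.

(* The alphabet {-1, +1} is encoded by bool, and a configuration indexed by
   the nonpositive integers by a map nat -> bool: [x n] stands for the
   coordinate of x at -n, so that the space is the library's Cantor space
   (product of discrete copies of bool). *)
Definition spin (a : bool) : int := if a then 1 else -1.

(* The same space with its Borel sigma-algebra. *)
Notation config := (g_sigma_algebraType (@open cantor_space)).

Definition concat (a : bool) (x : cantor_space) : cantor_space :=
  fun n => if n is k.+1 then x k else a.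

Definition Tshift (x : cantor_space) : cantor_space := fun n => x n.+1.

Definition subst0 (a : bool) (x : cantor_space) : cantor_space :=
  fun n => if n is _.+1 then x n else a.

Definition gfunction (R : realType) (g : cantor_space -> R) : Prop :=
  [/\ continuous g,
      forall x, 0 < g x < 1
    & forall x, \sum_(a : bool) g (concat a x) = 1].

(* h is a version of the conditional probability P(C | F), where F is a
   sub-sigma-algebra of the measurable sets. *)
Definition cond_prob d (T : measurableType d) (R : realType)
    (P : probability T R) (F : set (set T)) (C : set T) (h : T -> R) : Prop :=
  (forall Y : set R, measurable Y -> F (h @^-1` Y)) /\
  (forall E, F E -> (\int[P]_(x in E) (h x)%:E = P (C `&` E))%E).

Definition gmeasure (R : realType) (g : cantor_space -> R)
    (mu : probability config R) : Prop :=
  [/\ gfunction g,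
      forall B : set config, measurable B -> mu (Tshift @^-1` B) = mu B
    & forall a : bool,
        cond_prob mu
          (preimage_set_system setT Tshift (@measurable _ config))
          [set x : config | x 0%N = a]
          (fun x => g (subst0 a x))].

Definition BK_majority (R : realType) (eps : R) (m : nat)
    (x : cantor_space) : R :=
  let s := spin (x 0%N) * \sum_(1 <= l < m.+1) spin (x l) in
  (0 < s)%R%:R * (1 - eps) + (s < 0)%R%:R * eps.

(* Only the values of lam and m at indices j >= 1 are used. *)
Definition BK_model (R : realType) (eps : R) (lam : nat -> R) (m : nat -> nat)
    (x : cantor_space) : R :=
  limn (fun n => \sum_(1 <= j < n.+1) lam j * BK_majority eps (m j) x).

(* Main.v *)
Require Import Defs.
From HB Require Import structures.
From mathcomp Require Import all_boot all_order all_algebra.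
From mathcomp Require Import all_classical all_reals all_analysis.
From mathcomp Require Import measurable_realfun ring lra zify.

Import Order.TTheory GRing.Theory Num.Theory.
Import numFieldNormedType.Exports.

Set Implicit Arguments.
Unset Strict Implicit.
Unset Printing Implicit Defensive.

Local Open Scope classical_set_scope.
Local Open Scope ring_scope.

(** The letters +1 and -1 come with conditional probability 1/2 +- h/4, where
    the drift h is the sum over j of lam_j times the sign of the last m_j
    letters.  The dynamics is attractive and invariant under exchange of the
    two letters, so it is enough to show that, started from the all-plus past,
    the mean of h stays above a positive constant for ever: a limit of time
    averages is then an invariant measure that prefers +, and its flip is
    another one.

    Let B_l be the last scale of the block l, M = m_(B_l) the longest memory of
    the first l blocks, and w = (3/4)^l / 4 the weight of the block l+1; the
    later blocks weigh 3w together.  If at some time all the later blocks are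
    positive, then whatever the block l+1 does the first l blocks evolve with
    an additional bias of at least 3w - w; allowing for a few negative scales
    in the later blocks, a bias of w is left.  Two things then happen.

    - With such a bias the dynamics of the first l blocks has a positive mean
      drift: without bias, symmetry makes every majority rule centred, once the
      past is forgotten, and by attractiveness the bias can only help
      (biased_drift).  Since the memory is M and every letter has probability
      at least 1/4, the past is forgotten within a time of order 4^M.  An
      exponential martingale with a corrector (block_sum_deviation) shows that
      a sum of n letters is positive except with probability of order
      4^(O(M)) / n (biased_deviation).

    - Almost all scales of the block l+1 are far longer than 4^M: the block has
      b_(l+1) >= (M+1)^8 scales of equal weight, and for j >= 4M the scale m_j,
      at least 2^(8 j^2) - 1, dominates (long_scale_deviation).  The remaining
      short scales weigh at most a sixth of the block, which is the loss
      allowed above (field_lower).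

    So a long scale j of the block l+1 is negative at a given time only if the
    biased dynamics fails over a window of length m_j, or if a long scale of a
    later block was negative somewhere in that window.  By induction on time
    this has probability at most 2^-j (long_scale_persistence), the window
    m_j being negligible against 2^(4M') with M' = m_(B_(l+1)).  Applied to the
    blocks after the first, which weigh 3/4 against 1/4, this gives the lower
    bound on the drift (drift_persistence).

    All expectations at finite times are iterates of a transfer operator, so
    no probability space is needed for them.  Measures appear only at the end:
    an ultrafilter limit of time averages is a stationary mean on bounded
    observables (exists_stationary_mean), a measure with its values on
    cylinders is the law of a quantile map of a uniform variable
    (exists_cylinder_probability), and stationarity turns into the two
    defining properties of a g-measure because both sides of each are measures
    that agree on cylinders (mean_measure_gmeasure). *)

(** * Transfer operators *)

Section transfer.
Variable R : realType.
Implicit Types (q f g : cantor_space -> R) (x y : cantor_space).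

Definition transfer q f x : R :=
  q x * f (concat true x) + (1 - q x) * f (concat false x).

Lemma transferE q f x : transfer q f x =
  q x * f (concat true x) + (1 - q x) * f (concat false x).
Proof. by []. Qed.

Definition is_kernel q := forall x, 0 <= q x <= 1.

Definition le_config x y := forall n, x n ==> y n.

Definition nondecr f := forall x y, le_config x y -> f x <= f y.

Definition memory M f := forall x y, (forall i, (i < M)%N -> x i = y i) -> f x = f y.

Definition plus : cantor_space := fun=> true.
Definition minus : cantor_space := fun=> false.
Definition flip x : cantor_space := fun n => ~~ x n.

Lemma transfer_le q f g : is_kernel q -> (forall x, f x <= g x) ->
  forall x, transfer q f x <= transfer q g x.
Proof.
move=> kq fg x; rewrite /transfer; have /andP[q0 q1] := kq x.
by apply: lerD; apply: ler_wpM2l; rewrite ?subr_ge0.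
Qed.

Lemma iter_transfer_le q n f g : is_kernel q -> (forall x, f x <= g x) ->
  forall x, iter n (transfer q) f x <= iter n (transfer q) g x.
Proof. by move=> kq fg; elim: n => //= n ih; exact: transfer_le. Qed.

Lemma iter_transfer_lin q n a f g x :
  iter n (transfer q) (fun y => a * f y + g y) x =
  a * iter n (transfer q) f x + iter n (transfer q) g x.
Proof.
elim: n x => //= n ih x.
by rewrite /transfer !ih; ring.
Qed.

Lemma iter_transfer_cst q n (a : R) x : iter n (transfer q) (fun=> a) x = a.
Proof. by elim: n x => //= n ih x; rewrite /transfer !ih; ring. Qed.

Lemma iter_transferD q n f g x :
  iter n (transfer q) (fun y => f y + g y) x =
  iter n (transfer q) f x + iter n (transfer q) g x.
Proof.
rewrite -[in RHS](mul1r (iter n _ f x)) -iter_transfer_lin; congr (iter _ _ _ _).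
by apply/funext => y; rewrite mul1r.
Qed.

Lemma iter_transferZ q n a f x :
  iter n (transfer q) (fun y => a * f y) x = a * iter n (transfer q) f x.
Proof.
rewrite -[RHS]addr0 -(iter_transfer_cst q n 0 x) -iter_transfer_lin; congr (iter _ _ _ _).
by apply/funext => y; rewrite addr0.
Qed.

Lemma iter_transfer_sum q n (I : Type) (r : seq I) (P : pred I)
    (F : I -> cantor_space -> R) x :
  iter n (transfer q) (fun y => \sum_(i <- r | P i) F i y) x =
  \sum_(i <- r | P i) iter n (transfer q) (F i) x.
Proof.
elim: r => [|i r ih].
  rewrite big_nil -[RHS](iter_transfer_cst q n 0 x); congr (iter _ _ _ _).
  by apply/funext => y; rewrite big_nil.
have -> : (fun y => \sum_(j <- i :: r | P j) F j y) =
    (fun y => (if P i then 1 else 0) * F i y + \sum_(j <- r | P j) F j y).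
  by apply/funext => y; rewrite big_cons; case: ifP => _; rewrite ?mul1r ?mul0r ?add0r.
by rewrite iter_transfer_lin ih big_cons; case: ifP; rewrite ?mul1r ?mul0r ?add0r.
Qed.

Lemma iter_transfer_bound q n f (a b : R) : is_kernel q ->
  (forall x, a <= f x <= b) -> forall x, a <= iter n (transfer q) f x <= b.
Proof.
move=> kq fab x; rewrite -{1}(iter_transfer_cst q n a x) -(iter_transfer_cst q n b x).
by apply/andP; split; apply: iter_transfer_le => // y; have /andP[] := fab y.
Qed.

Lemma le_config_refl x : le_config x x.
Proof. by move=> n; rewrite implybb. Qed.

Lemma le_plus x : le_config x plus.
Proof. by move=> n; rewrite implybT. Qed.

Lemma minus_le x : le_config minus x.
Proof. by []. Qed.

Lemma le_concat a b x y : a ==> b -> le_config x y ->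
  le_config (concat a x) (concat b y).
Proof. by move=> ab xy [|n] /=; [exact: ab|exact: xy]. Qed.

Lemma flip_concat a x : flip (concat a x) = concat (~~ a) (flip x).
Proof. by apply/funext => -[|n]. Qed.

Lemma flip_plus : flip plus = minus. Proof. exact/funext. Qed.

(** Attractiveness: the letter + gives the higher future, and a higher kernel
    makes it likelier, so kernel, past and observable can be raised together. *)
Lemma transfer_attractive q1 q2 f g x y : is_kernel q1 -> is_kernel q2 ->
  nondecr f -> (forall z, f z <= g z) -> q1 x <= q2 y -> le_config x y ->
  transfer q1 f x <= transfer q2 g y.
Proof.
move=> k1 k2 mf fg q12 xy; rewrite /transfer.
have f1 : f (concat true x) <= g (concat true y).
  by apply: le_trans (fg _); apply: mf; exact: le_concat.
have f2 : f (concat false x) <= g (concat false y).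
  by apply: le_trans (fg _); apply: mf; exact: le_concat.
have f3 : f (concat false x) <= f (concat true x).
  by apply: mf; apply: le_concat => //; exact: le_config_refl.
have /andP[a0 a1] := k1 x; have /andP[b0 b1] := k2 y.
have : 0 <= (q2 y - q1 x) * (f (concat true x) - f (concat false x)).
  by apply: mulr_ge0; rewrite subr_ge0.
have : 0 <= q2 y * (g (concat true y) - f (concat true x)).
  by apply: mulr_ge0; rewrite ?subr_ge0.
have : 0 <= (1 - q2 y) * (g (concat false y) - f (concat false x)).
  by apply: mulr_ge0; rewrite ?subr_ge0.
by lra.
Qed.

Lemma nondecr_iter q n f : is_kernel q -> nondecr q -> nondecr f ->
  nondecr (iter n (transfer q) f).
Proof.
move=> kq mq mf; elim: n => //= n ih x y xy.
by apply: transfer_attractive => //; exact: mq.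
Qed.

Lemma iter_attractive q1 q2 n f : is_kernel q1 -> is_kernel q2 -> nondecr q1 ->
  (forall x, q1 x <= q2 x) -> nondecr f ->
  forall x, iter n (transfer q1) f x <= iter n (transfer q2) f x.
Proof.
move=> k1 k2 m1 q12 mf; elim: n => //= n ih x.
by apply: transfer_attractive => //; [exact: nondecr_iter|exact: le_config_refl].
Qed.

Lemma memory_iter q n M f : memory M q -> memory M f ->
  memory M (iter n (transfer q) f).
Proof.
move=> lq lf; elim: n => //= n ih x y xy; rewrite /transfer (lq _ _ xy).
suff E a : iter n (transfer q) f (concat a x) = iter n (transfer q) f (concat a y).
  by rewrite !E.
by apply: ih => -[//|i] iM /=; apply: xy; exact: ltnW.
Qed.

Lemma iter_transfer_flip q n f : (forall x, q (flip x) = 1 - q x) ->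
  forall x, iter n (transfer q) f (flip x) =
            iter n (transfer q) (f \o flip) x.
Proof.
move=> qF; elim: n => //= n ih x; rewrite /transfer qF.
rewrite -!ih !flip_concat /=; ring.
Qed.

(** Doeblin minorisation: whatever the past, k successive letters are all +
    with probability at least 4^-k, and on the rest of the space a
    nondecreasing observable is at least its value at the all-minus past. *)
Lemma iter_transfer_minor q f k x : is_kernel q -> (forall x, 1 / 4 <= q x) ->
  nondecr f ->
  (1 / 4) ^+ k * f (iter k (concat true) x) + (1 - (1 / 4) ^+ k) * f minus
  <= iter k (transfer q) f x.
Proof.
move=> kq q4 mf.
have fmin z : f minus <= f z by exact: mf.
have Lmin n z : f minus <= iter n (transfer q) f z.
  by rewrite -(iter_transfer_cst q n (f minus) z); exact: iter_transfer_le.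
elim: k x => [|k ih] x; first by rewrite expr0 subrr mul0r mul1r addr0.
rewrite iterSr iterS transferE.
move: (ih (concat true x)) (Lmin k (concat false x)) (q4 x) (kq x).
move: (fmin (iter k (concat true) (concat true x))).
have := exprn_ge0 k (_ : 0 <= 1 / 4 :> R); move=> /(_ ltac:(lra)).
rewrite exprS; set p := (1 / 4) ^+ k; set F := f (iter _ _ _); set m := f minus.
set G := iter _ _ _ _; set H := iter _ _ _ _ => p0 mF hG hH hq /andP[_ hq1].
have : 0 <= p * (F - m) by apply: mulr_ge0 => //; rewrite subr_ge0.
move=> pF; have : 0 <= (q x - 1 / 4) * (G - m).
  by apply: mulr_ge0; lra.
have : 0 <= (1 - q x) * (H - m) by apply: mulr_ge0; rewrite subr_ge0.
lra.
Qed.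

Lemma iter_concat_plus k x i : (i < k)%N -> iter k (concat true) x i = true.
Proof. by elim: k i => //= k ih [|i] //= /ih. Qed.

(** A run of M pluses erases a memory of length M; it has probability at least
    4^-M in each window of length M, and the gap between the two extreme pasts
    survives only where it is missing. *)
Lemma iter_transfer_contract q f M k : is_kernel q -> (forall x, 1 / 4 <= q x) ->
  nondecr q -> memory M q -> nondecr f -> memory M f ->
  iter (k * M) (transfer q) f plus - iter (k * M) (transfer q) f minus
  <= (1 - (1 / 4) ^+ M) ^+ k * (f plus - f minus).
Proof.
move=> kq q4 mq lq mf lf; elim: k => [|k ih]; first by rewrite expr0 mul1r.
rewrite mulSn iterD; set g := iter (k * M) _ f in ih *.
have mg : nondecr g by exact: nondecr_iter.
have lg : memory M g by exact: memory_iter.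
have := @iter_transfer_minor q g M minus kq q4 mg.
rewrite (lg _ plus); last by move=> i; exact: iter_concat_plus.
have : iter M (transfer q) g plus <= g plus.
  rewrite -[leRHS](iter_transfer_cst q M _ plus).
  by apply: iter_transfer_le => // z; apply: mg; exact: le_plus.
have p1 : 0 <= 1 - (1 / 4 : R) ^+ M.
  by rewrite subr_ge0 exprn_ile1 //; lra.
have := ler_wpM2l p1 ih.
rewrite exprS; set p := (1 / 4) ^+ M.
by lra.
Qed.

Lemma iter_transfer_minus_incr q f n n' : is_kernel q -> nondecr f ->
  (n <= n')%N -> nondecr q ->
  iter n (transfer q) f minus <= iter n' (transfer q) f minus.
Proof.
move=> kq mf nn mq; rewrite -(subnK nn) iterD.
rewrite -[leLHS](iter_transfer_cst q (n' - n) _ minus).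
apply: iter_transfer_le => // z; apply: nondecr_iter => //; exact: minus_le.
Qed.

Lemma iter_transfer_plus_decr q f n n' : is_kernel q -> nondecr f ->
  (n <= n')%N -> nondecr q ->
  iter n' (transfer q) f plus <= iter n (transfer q) f plus.
Proof.
move=> kq mf nn mq; rewrite -(subnK nn) iterD.
rewrite -[leRHS](iter_transfer_cst q (n' - n) _ plus).
apply: iter_transfer_le => // z; apply: nondecr_iter => //; exact: le_plus.
Qed.

Lemma bernoulli_decay (d : R) k : 0 < d <= 1 -> (0 < k)%N ->
  (1 - d) ^+ k <= (k%:R * d)^-1.
Proof.
move=> /andP[d0 d1] k0.
have kd : 0 < k%:R * d by rewrite mulr_gt0 // ltr0n.
rewrite -(ler_pM2r kd) mulVf ?gt_eqF //.
have b n : 1 + n%:R * d <= (1 + d) ^+ n.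
  elim: n => [|n ih]; first by rewrite mul0r addr0 expr0.
  have := @ler_wpM2l _ (1 + d) ltac:(lra) _ _ ih.
  have : 0 <= n%:R * d * d by rewrite !mulr_ge0 ?ler0n // ltW.
  rewrite exprS -natr1; lra.
have d1' : 0 <= (1 - d) ^+ k by rewrite exprn_ge0 // subr_ge0.
apply: (@le_trans _ _ ((1 - d) ^+ k * (1 + d) ^+ k)).
  by apply: ler_wpM2l => //; have := b k; lra.
rewrite -exprMn exprn_ile1 //; nra.
Qed.

(** By the flip symmetry the two extreme pasts give opposite means to an odd
    observable, and their gap is what contracts. *)
Lemma odd_observable_lower q f M k n : is_kernel q -> (forall x, 1 / 4 <= q x) ->
  nondecr q -> memory M q -> nondecr f -> memory M f ->
  (forall x, q (flip x) = 1 - q x) -> (forall x, f (flip x) = - f x) ->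
  (forall x, f x <= 1) -> (0 < k)%N -> (k * M <= n)%N ->
  - (4 ^+ M / k%:R) <= iter n (transfer q) f minus.
Proof.
move=> kq q4 mq lq mf lf qF fF f1 k0 kn.
apply: le_trans (iter_transfer_minus_incr kq mf kn mq).
have := iter_transfer_contract k kq q4 mq lq mf lf.
have E : iter (k * M) (transfer q) f plus = - iter (k * M) (transfer q) f minus.
  rewrite -flip_plus iter_transfer_flip //.
  have -> : f \o flip = (fun y => -1 * f y).
    by apply/funext => y; rewrite /= fF mulN1r.
  by rewrite iter_transferZ mulN1r opprK.
have Em : f minus = - f plus by rewrite -flip_plus fF.
rewrite E Em.
have d0 : 0 < (1 / 4 : R) ^+ M <= 1.
  by rewrite exprn_gt0 ?exprn_ile1 //; lra.
have := bernoulli_decay d0 k0.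
have -> : (k%:R * (1 / 4) ^+ M)^-1 = 4 ^+ M / k%:R :> R.
  by rewrite invfM mulrC div1r exprVn invrK.
have := f1 plus.
set P := (1 - _) ^+ k => fp PB H.
have P0 : 0 <= P by apply: exprn_ge0; case/andP: d0; rewrite subr_ge0.
have : P * f plus <= P by rewrite ler_piMr.
lra.
Qed.

(** Replacing one letter drawn with q1 by one drawn with q2 changes the mean of
    a nonincreasing observable with values in the unit interval by at most the
    deficit D; as q2 is attractive, its iterates keep the observable
    nonincreasing, and the replacements add up. *)
Lemma iter_transfer_compare q1 q2 D n f : is_kernel q1 -> is_kernel q2 ->
  nondecr q2 -> (forall x, 0 <= D x) -> (forall x, q2 x <= q1 x + D x) ->
  (forall x, 0 <= f x <= 1) -> nondecr (fun x => - f x) ->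
  forall x, iter n (transfer q1) f x <=
    iter n (transfer q2) f x + \sum_(0 <= t < n) iter t (transfer q1) D x.
Proof.
move=> k1 k2 m2 D0 q21 f01 mf; elim: n => [|n ih] x.
  by rewrite big_geq // addr0.
set g := iter n (transfer q2) f in ih *.
have g01 z : 0 <= g z <= 1 by exact: iter_transfer_bound.
have mg : nondecr (fun x => - g x).
  have -> : (fun x => - g x) = iter n (transfer q2) (fun x => - f x).
    apply/funext => z; rewrite -mulN1r -iter_transferZ; congr (iter _ _ _ _).
    by apply/funext => w; rewrite mulN1r.
  exact: nondecr_iter.
apply: (@le_trans _ _ (transfer q1 (fun y => g y +
    \sum_(0 <= t < n) iter t (transfer q1) D y) x)).
  exact: transfer_le.
have := iter_transferD q1 1 g (fun y => \sum_(0 <= t < n) iter t (transfer q1) D y) x.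
have := iter_transfer_sum q1 1 (index_iota 0 n) xpredT (fun t => iter t (transfer q1) D) x.
move=> /= -> ->.
rewrite big_nat_recl //= addrA lerD2r -/(transfer q2 g) !transferE.
have gg : 0 <= g (concat false x) - g (concat true x).
  rewrite subr_ge0 -lerN2; apply: mg; apply: le_concat => //; exact: le_config_refl.
have := q21 x; have := D0 x.
have /andP[a0 a1] := g01 (concat false x); have /andP[b0 b1] := g01 (concat true x).
move=> Dx qx.
have : (q2 x - q1 x) * (g (concat false x) - g (concat true x)) <= D x.
  apply: (@le_trans _ _ (D x * (g (concat false x) - g (concat true x)))).
    by apply: ler_wpM2r => //; lra.
  by apply: ler_piMr => //; lra.
rewrite -/g; lra.
Qed.

End transfer.

(** * Large deviations of block sums *)

Section large_deviations.
Variable R : realType.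
Implicit Types (q u : cantor_space -> R) (x : cantor_space).

Definition block_sum m x : int := \sum_(0 <= i < m) spin (x i).

Definition minority m x : R := (block_sum m x <= 0)%R%:R.

Lemma block_sum_concat m a x :
  block_sum m.+1 (concat a x) = spin a + block_sum m x.
Proof. by rewrite /block_sum big_nat_recl. Qed.

Lemma minority01 m x : 0 <= minority m x <= 1.
Proof. by rewrite /minority; case: (_ <= 0)%R; rewrite ?lexx ?ler01. Qed.

Lemma expRN_quadratic (v : R) : - (1 / 2) <= v -> expR (- v) <= 1 - v + 2 * v ^+ 2.
Proof.
move=> v2; have v1 : 0 < 1 + v by lra.
rewrite expRN; apply: (@le_trans _ _ (1 + v)^-1).
  by rewrite lef_pV2 ?posrE ?expR_gt0 // expR_ge1Dx.
rewrite -(ler_pM2l v1) divff ?gt_eqF //.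
have : 0 <= v ^+ 2 * (1 + 2 * v) by apply: mulr_ge0; [exact: sqr_ge0|lra].
rewrite (_ : (1 + v) * _ = 1 + v ^+ 2 * (1 + 2 * v)); [lra|ring].
Qed.

(** The corrector u turns the block sum into a process with drift at least a
    and increments at most 1 + 2 U at every step, whose exponential moments
    decay geometrically; a geometric decay at rate d is at most 1 / (m d). *)
Lemma block_sum_deviation q u (a U : R) m x : is_kernel q ->
  (forall y, `|u y| <= U) -> 0 < a <= 1 -> (0 < m)%N ->
  (forall y, a + u y <= q y * (1 + u (concat true y))
                      + (1 - q y) * (-1 + u (concat false y))) ->
  iter m (transfer q) (minority m) x <= 16 * (1 + 2 * U) ^+ 2 / (a ^+ 2 * m%:R).
Proof.
move=> kq uU /andP[a0 a1] m0 drift.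
have U0 : 0 <= U by apply: le_trans (uU x).
set C := 1 + 2 * U.
have C1 : 1 <= C by rewrite /C; lra.
have C2 : 0 < C ^+ 2 by apply: exprn_gt0; lra.
(* The minimiser of - th * a + 2 * th ^+ 2 * C ^+ 2, the cost of one step. *)
pose th := a / (4 * C ^+ 2).
have thE : th * C ^+ 2 = a / 4 by rewrite /th; field; rewrite gt_eqF //; lra.
have th0 : 0 < th by rewrite /th divr_gt0 // mulr_gt0.
have thC : th * C <= 1 / 4.
  have : th * C <= th * C ^+ 2.
    by rewrite ler_pM2l // expr2 ler_peMr //; lra.
  by rewrite thE; lra.
pose rho := 1 - a ^+ 2 / (8 * C ^+ 2).
pose E k y := expR (- (th * ((block_sum k y)%:~R + u y))).
have step k y : transfer q (E k.+1) y <= rho * E k y.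
  have Ea b : E k.+1 (concat b y) =
      E k y * expR (- (th * ((spin b)%:~R + u (concat b y) - u y))).
    rewrite /E -expRD block_sum_concat intrD; congr expR; ring.
  rewrite transferE !Ea /=.
  have bnd (d : R) : `|d| <= 1 ->
      expR (- (th * (d + u (concat (0 < d) y) - u y)))
      <= 1 - th * (d + u (concat (0 < d) y) - u y) + 2 * th ^+ 2 * C ^+ 2.
    move=> d1; set D := d + _ - _.
    have DC : `|D| <= C.
      rewrite /D /C; apply: le_trans (ler_normB _ _) _.
      have := ler_normD d (u (concat (0 < d) y)).
      by have := uU y; have := uU (concat (0 < d) y); lra.
    have thD : `|th * D| <= 1 / 4.
      rewrite normrM gtr0_norm //; apply: le_trans thC.
      by rewrite ler_pM2l.
    apply: le_trans (expRN_quadratic _) _.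
      by move: thD; rewrite ler_norml => /andP[]; lra.
    rewrite exprMn -mulrA lerD2l ler_pM2l // ler_pM2l ?exprn_gt0 //.
    rewrite -(real_normK (num_real D)).
    by rewrite ler_pXn2r // ?nnegrE //; lra.
  have := bnd 1; rewrite normr1 ltr01 => /(_ (lexx _)).
  have := bnd (-1); rewrite normrN1 oppr_gt0 ltr10 => /(_ (lexx _)).
  rewrite mulrNz mulr1z.
  set e2 := expR _; set e1 := expR _ => b2 b1.
  have Ek : 0 < E k y by exact: expR_gt0.
  have /andP[q0 q1] := kq y.
  have := ler_wpM2l q0 b1.
  have q1' : 0 <= 1 - q y by lra.
  have := ler_wpM2l q1' b2.
  have := drift y.
  set u1 := u (concat true y); set u2 := u (concat false y) => dr h2 h1.
  have dr' := ler_wpM2l (ltW th0) dr.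
  have rhoE : rho = 1 - th * a + 2 * th ^+ 2 * C ^+ 2.
    rewrite /rho /th; field; rewrite gt_eqF //; lra.
  have : q y * e1 + (1 - q y) * e2 <= rho by rewrite rhoE; lra.
  move=> /(ler_wpM2l (ltW Ek)); lra.
have rho0 : 0 <= rho.
  rewrite /rho subr_ge0 ler_pdivrMr ?mul1r; last by rewrite mulr_gt0.
  apply: (@le_trans _ _ 1); first by rewrite exprn_ile1 // ltW.
  have : 1 <= C ^+ 2 by apply: exprn_ege1.
  lra.
have iterE k y : iter k (transfer q) (E k) y <= rho ^+ k * E 0%N y.
  elim: k y => [|k ih] y; first by rewrite expr0 mul1r.
  rewrite iterSr; apply: (@le_trans _ _ (iter k (transfer q) (fun z => rho * E k z) y)).
    exact: iter_transfer_le.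
  by rewrite iter_transferZ exprS -mulrA ler_wpM2l.
have minorityE y : minority m y <= expR (th * U) * E m y.
  rewrite /minority /E -expRD; case: (lerP (block_sum m y) 0) => S0 /=; last exact: expR_ge0.
  rewrite -[leLHS]expR0 ler_expR.
  have : (block_sum m y)%:~R <= 0 :> R by rewrite lerz0.
  have := uU y; rewrite ler_norml => /andP[_ uy] S0'.
  rewrite -mulrBr mulr_ge0 //; lra.
apply: le_trans (iter_transfer_le m kq minorityE x) _.
rewrite iter_transferZ.
apply: (@le_trans _ _ (2 * rho ^+ m)).
  apply: (@le_trans _ _ (expR (th * U) * (rho ^+ m * E 0%N x))).
    by rewrite ler_wpM2l // expR_ge0.
  rewrite mulrCA mulrC ler_wpM2r ?exprn_ge0 //.
  rewrite /E /block_sum big_geq // mulr0z add0r -expRD.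
  apply: (@le_trans _ _ (expR (- - (2 * (th * U))))).
    rewrite ler_expR opprK.
    have := uU x; rewrite ler_norml => /andP[ux _].
    have := ler_wpM2l (ltW th0) ux; lra.
  have thU : 0 <= th * U by rewrite mulr_ge0 // ltW.
  have thU2 : th * U <= 1 / 8 by move: thC; rewrite /C; lra.
  apply: le_trans (expRN_quadratic _) _; first lra.
  have : (th * U) ^+ 2 <= (1 / 8) ^+ 2 by rewrite ler_pXn2r // nnegrE //; lra.
  rewrite sqrrN exprMn; lra.
pose d := a ^+ 2 / (8 * C ^+ 2).
have d01 : 0 < d <= 1.
  apply/andP; split; first by apply: divr_gt0; [exact: exprn_gt0|exact: mulr_gt0].
  by move: rho0; rewrite /rho subr_ge0.
have := bernoulli_decay d01 m0; rewrite -/rho => h.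
apply: (@le_trans _ _ (2 * (m%:R * d)^-1)); first by rewrite ler_pM2l.
rewrite le_eqVlt; apply/orP; left; apply/eqP; rewrite /d; field.
by rewrite !gt_eqF ?ltr0n //; lra.
Qed.

End large_deviations.

(** * Finitely many majority rules with a positive bias *)

Section majority_field.
Variable R : realType.
Implicit Types (x y : cantor_space).
Local Notation minority := (@minority R).
Local Notation minus := (minus : cantor_space).

Lemma block_sum_le m x y : le_config x y -> block_sum m x <= block_sum m y.
Proof.
move=> xy; apply: ler_sum => i _; have := xy i.
by rewrite /spin; case: (x i) (y i) => -[].
Qed.

Lemma block_sum_flip m x : block_sum m (flip x) = - block_sum m x.
Proof.
rewrite /block_sum -sumrN; apply: eq_bigr => i _.
by rewrite /spin /flip; case: (x i); rewrite ?opprK.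
Qed.

Lemma block_sum_odd_neq0 m x : odd m -> block_sum m x != 0.
Proof.
have [k ->] : exists k : int, block_sum m x = m%:Z + 2 * k.
  elim: m => [|m [k ih]]; first by exists 0; rewrite /block_sum big_geq.
  rewrite /block_sum big_nat_recr //= -/(block_sum m x) ih /spin.
  by case: (x m); [exists k|exists (k - 1)]; lia.
move=> om; apply/negP => /eqP; lia.
Qed.

Definition majority m x : R := 1 - 2 * minority m x.

Lemma nondecr_minorityN m : nondecr (fun x => - minority m x).
Proof.
move=> x y xy; rewrite lerN2 /minority; have := block_sum_le m xy.
case: (lerP (block_sum m y) 0) => [y0|_]; last by case: (_ <= 0)%R.
by move=> /le_trans/(_ y0) ->.
Qed.

Lemma nondecr_majority m : nondecr (majority m).
Proof. by move=> x y /(nondecr_minorityN m); rewrite /majority; lra. Qed.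

Lemma block_sum_memory M m x y : (m <= M)%N ->
  (forall i, (i < M)%N -> x i = y i) -> block_sum m x = block_sum m y.
Proof.
move=> mM xy; apply: eq_big_nat => i /andP[_ im].
by rewrite xy // (leq_trans im).
Qed.

Lemma memory_majority M m : (m <= M)%N -> memory M (majority m).
Proof.
by move=> mM x y xy; rewrite /majority /minority (block_sum_memory mM xy).
Qed.

Lemma majority_flip m x : odd m -> majority m (flip x) = - majority m x.
Proof.
move=> om; rewrite /majority /minority block_sum_flip oppr_le0.
have := block_sum_odd_neq0 x om.
by case: ltrgtP => //= _ _; ring.
Qed.

Lemma majority_bound m x : -1 <= majority m x <= 1.
Proof. by have := minority01 R m x; rewrite /majority; lra. Qed.

Variables (ms : nat -> nat) (lam : nat -> R).

Definition field N x : R := \sum_(1 <= j < N.+1) lam j * majority (ms j) x.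

Section bounded_memory.
Variables (N M : nat).
Hypothesis lam_ge0 : forall j, (1 <= j)%N -> 0 <= lam j.
Hypothesis ms_odd : forall j, (1 <= j)%N -> odd (ms j).
Hypothesis ms_le : forall j, (1 <= j <= N)%N -> (ms j <= M)%N.

Lemma nondecr_field : nondecr (field N).
Proof.
move=> x y xy; apply: ler_sum_nat => j /andP[j1 _].
by rewrite ler_wpM2l ?lam_ge0 //; exact: nondecr_majority.
Qed.

Lemma memory_field : memory M (field N).
Proof.
move=> x y xy; apply: eq_big_nat => j j1.
by rewrite (memory_majority (ms_le j1) xy).
Qed.

Lemma field_flip x : field N (flip x) = - field N x.
Proof.
rewrite /field -sumrN; apply: eq_big_nat => j /andP[j1 _].
by rewrite majority_flip ?ms_odd // mulrN.
Qed.

Lemma field_bound x : `|field N x| <= \sum_(1 <= j < N.+1) lam j.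
Proof.
apply: le_trans (ler_norm_sum _ _ _) _; apply: ler_sum_nat => j /andP[j1 _].
rewrite normrM ger0_norm ?lam_ge0 // ler_piMr ?lam_ge0 // ler_norml.
exact: majority_bound.
Qed.

Variable w : R.
Hypothesis w0 : 0 < w.
Hypothesis lam_sum : \sum_(1 <= j < N.+1) lam j + w <= 1.

Definition biased (b : R) x := 1 / 2 + (field N x + b) / 4.

Lemma biased_bound b x : 0 <= b <= w -> 1 / 4 <= biased b x <= 3 / 4.
Proof.
move: (lam_sum) => ls /andP[b0 bw]; have := field_bound x.
by rewrite ler_norml /biased => /andP[f1 f2]; apply/andP; split; lra.
Qed.

Lemma biased_is_kernel b : 0 <= b <= w -> is_kernel (biased b).
Proof. by move=> bw x; have := biased_bound x bw; lra. Qed.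

Lemma nondecr_biased b : nondecr (biased b).
Proof. by move=> x y /nondecr_field; rewrite /biased; lra. Qed.

Lemma memory_biased b : memory M (biased b).
Proof. by move=> x y /memory_field; rewrite /biased => ->. Qed.

(** By attractiveness each majority rule is at least as favourable as in the
    unbiased dynamics, where it is centred up to 4^M / k, at most w / 2; so the
    field cancels at most half of the bias. *)
Lemma biased_drift k n x : (0 < k)%N -> 2 * 4 ^+ M <= w * k%:R ->
  (k * M <= n)%N ->
  w / 4 <= iter n (transfer (biased w)) (fun y => 2 * biased w y - 1) x.
Proof.
move=> k0 kw kn; move: (w0) => wp.
have w0w : 0 <= w <= w by lra.
have w00 : 0 <= (0 : R) <= w by lra.
have E : (fun y => 2 * biased w y - 1) = (fun y => 1 / 2 * field N y + w / 2).
  by apply/funext => y; rewrite /biased; lra.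
rewrite E iter_transfer_lin iter_transfer_cst.
have -> : iter n (transfer (biased w)) (field N) x =
  \sum_(1 <= j < N.+1) lam j * iter n (transfer (biased w)) (majority (ms j)) x.
  rewrite iter_transfer_sum; apply: eq_bigr => j _.
  by rewrite iter_transferZ.
suff : - (w / 2) <= \sum_(1 <= j < N.+1)
    lam j * iter n (transfer (biased w)) (majority (ms j)) x by lra.
apply: (@le_trans _ _ (\sum_(1 <= j < N.+1) lam j * - (w / 2))).
  rewrite -mulr_suml.
  move: lam_sum; set S := \sum_(1 <= j < N.+1) lam j => lS.
  by rewrite mulrN lerN2 ler_piMl; lra.
apply: ler_sum_nat => j /andP[j1 jN]; apply: ler_wpM2l; first exact: lam_ge0.
have kq0 := biased_is_kernel w00; have kqw := biased_is_kernel w0w.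
apply: (@le_trans _ _ (iter n (transfer (biased w)) (majority (ms j)) minus)); last first.
  apply: nondecr_iter => //; [exact: nondecr_biased|exact: nondecr_majority].
apply: (@le_trans _ _ (iter n (transfer (biased 0)) (majority (ms j)) minus)); last first.
  apply: iter_attractive => //; first exact: nondecr_biased.
    by move=> y; rewrite /biased; lra.
  exact: nondecr_majority.
apply: (@le_trans _ _ (- (4 ^+ M / k%:R))).
  rewrite lerN2 ler_pdivrMr ?ltr0n //; lra.
apply: (@odd_observable_lower R (biased 0) (majority (ms j)) M k n) => //.
- by move=> y; have /andP[] := biased_bound y w00.
- exact: nondecr_biased.
- exact: memory_biased.
- exact: nondecr_majority.
- by apply: memory_majority; apply: ms_le; rewrite j1.
- by move=> y; rewrite /biased field_flip; lra.
- by move=> y; rewrite majority_flip // ms_odd.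
- by move=> y; have /andP[] := majority_bound (ms j) y.
Qed.

(** The corrector is the sum of the expected drifts up to the relaxation time
    k * M: one step of the dynamics then replaces the present drift by the one
    at the relaxation time, which is at least w / 4. *)
Lemma biased_deviation k n x : (0 < k)%N -> (0 < M)%N -> (0 < n)%N ->
  2 * 4 ^+ M <= w * k%:R ->
  iter n (transfer (biased w)) (minority n) x <=
  16 * (1 + 2 * (k * M)%:R) ^+ 2 / ((w / 4) ^+ 2 * n%:R).
Proof.
move=> k0 M0 n0 kw; move: (w0) (lam_sum) => wp ls; have w0w : 0 <= w <= w by lra.
have kqw := biased_is_kernel w0w.
pose y := fun z => 2 * biased w z - 1.
pose u z := \sum_(0 <= t < k * M) iter t (transfer (biased w)) y z.
apply: (@block_sum_deviation R (biased w) u) => //.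
- move=> z; apply: le_trans (ler_norm_sum _ _ _) _.
  have -> : (k * M)%:R = \sum_(0 <= t < k * M) 1 :> R.
    by rewrite sumr_const_nat subn0.
  apply: ler_sum => t _; rewrite ler_norml; apply: iter_transfer_bound => // v.
  by have := biased_bound v w0w; rewrite /y; lra.
- have : 0 <= \sum_(1 <= j < N.+1) lam j.
    by rewrite big_nat sumr_ge0 // => j /andP[j1 _]; exact: lam_ge0.
  lra.
- move=> z.
  have Eu : transfer (biased w) u z =
      \sum_(0 <= t < k * M) iter t.+1 (transfer (biased w)) y z.
    exact: (@iter_transfer_sum R (biased w) 1 nat (index_iota 0 (k * M)) xpredT
      (fun t => iter t (transfer (biased w)) y) z).
  have Et : u z + iter (k * M) (transfer (biased w)) y z =
      y z + transfer (biased w) u z.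
    by rewrite Eu /u -big_nat_recr // big_nat_recl.
  have := @biased_drift k (k * M)%N z k0 kw (leqnn _); rewrite -/y.
  move: Et; rewrite transferE /y; lra.
Qed.

End bounded_memory.
End majority_field.

(** * Cylinders *)

Definition prefix_eq n (x y : cantor_space) := forall i, (i < n)%N -> x i = y i.

Lemma near_prefix_eq n (x : cantor_space) : \forall y \near x, prefix_eq n x y.
Proof.
elim: n => [|n ih]; first by near=> y => i; rewrite ltn0.
have oi : open ((fun y : cantor_space => y n) @^-1` [set x n]).
  apply: open_comp; [move=> y _|exact: discrete_open].
  exact: (@proj_continuous _ (fun _ : nat => bool) n y).
have nn : \forall y \near x, y n = x n by exact: open_nbhs_nbhs.
near=> y => i; rewrite ltnS leq_eqVlt => /predU1P[->|].
  by apply/esym; near: y.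
by move: i; near: y.
Unshelve. all: by end_near. Qed.

(** The sets of continuations of the prefixes of x generate a filter that
    converges to x coordinatewise, hence for the product topology. *)
Lemma open_prefix (O : set cantor_space) x : open O -> O x ->
  exists n, forall y, prefix_eq n x y -> O y.
Proof.
move=> oO Ox; pose F := filter_from [set: nat] (fun n => [set y | prefix_eq n x y]).
have FF : Filter F.
  apply: filter_from_filter; first by exists 0%N.
  move=> i j _ _; exists (maxn i j) => // y xy.
  by split=> k ki; apply: xy; rewrite leq_max ki ?orbT.
have : F --> x.
  apply/cvg_sup => i A; rewrite nbhsE => -[U [[V oV <-] Vx] UA].
  exists i.+1 => // y /(_ i (leqnn _)) xy; apply: UA.
  by move: Vx; rewrite /preimage /= xy.
move=> /(_ O) []; first exact: open_nbhs_nbhs.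
by move=> n _ On; exists n.
Qed.

Section uniform_limits.
Variable R : realType.

Lemma continuous_prefix (f : cantor_space -> R) :
  (forall e, 0 < e -> exists n, forall x y, prefix_eq n x y -> `|f x - f y| <= e) ->
  continuous f.
Proof.
move=> fn x; apply/cvgrPdist_le => e e0; have [n xy] := fn e e0.
by near=> y; apply: xy; near: y; exact: near_prefix_eq.
Unshelve. all: by end_near. Qed.

End uniform_limits.

(** Words are read backwards: the head of t is the letter at index (size t).-1,
    so that refining a cylinder is a cons. *)
Fixpoint in_cylinder (t : seq bool) (x : cantor_space) : bool :=
  if t is a :: t' then (x (size t') == a) && in_cylinder t' x else true.

Definition cylinder t : set cantor_space := [set x | in_cylinder t x].

Fixpoint prefix (x : cantor_space) n : seq bool :=
  if n is n'.+1 then x n' :: prefix x n' else [::].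

Lemma size_prefix x n : size (prefix x n) = n.
Proof. by elim: n => //= n ->. Qed.

Lemma in_cylinderE t x : in_cylinder t x = (prefix x (size t) == t).
Proof. by elim: t => //= a t ->; rewrite eqseq_cons. Qed.

Lemma prefix_eqP n x y : prefix_eq n x y <-> prefix x n = prefix y n.
Proof.
split; elim: n => //= n ih.
  by move=> xy; rewrite xy // ih // => i im; apply: xy; exact: ltnW.
move=> [xn /ih xy] i; rewrite ltnS leq_eqVlt => /predU1P[->|] //; exact: xy.
Qed.

Lemma open_bigcup_cylinder (O : set cantor_space) : open O ->
  O = \bigcup_(t in [set t | cylinder t `<=` O]) cylinder t.
Proof.
move=> oO; apply/seteqP; split=> [x Ox|x [t tO /tO]]; last by [].
have [n nO] := open_prefix oO Ox.
have E y : cylinder (prefix x n) y <-> prefix_eq n x y.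
  rewrite prefix_eqP /cylinder /= in_cylinderE size_prefix.
  by split=> [/eqP|->].
exists (prefix x n); last by apply/E.
by move=> y /E /nO.
Qed.

Lemma open_cylinder t : open (cylinder t).
Proof.
rewrite openE => x xt; apply: filterS (near_prefix_eq (size t) x) => y.
by rewrite prefix_eqP => E; move: xt; rewrite /cylinder /= !in_cylinderE E.
Qed.

Lemma measurable_cylinder t : measurable (cylinder t : set config).
Proof. by apply: sub_sigma_algebra; exact: open_cylinder. Qed.

(** Cylinders are countably many, so a map into the space is measurable as soon
    as its preimages of cylinders are. *)
Lemma measurable_fun_cylinder d (T : measurableType d) (f : T -> config) :
  (forall t, measurable (f @^-1` cylinder t)) -> measurable_fun setT f.
Proof.
move=> mf; apply: measurability => // _ [U oU <-].
rewrite setTI (open_bigcup_cylinder oU) preimage_bigcup bigcup_mkcond.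
apply: countable_bigcupT_measurable; first exact: countableP.
by move=> t; case: ifP => _; [exact: mf|exact: measurable0].
Qed.

Lemma continuous_measurable_config (R : realType) (f : cantor_space -> R) :
  continuous f -> measurable_fun setT (f : config -> R).
Proof.
move=> cf; apply: (measurability _ (@RGenOpens.measurableE R)) => // _ [_ [a [b ->]] <-].
rewrite setTI; apply: sub_sigma_algebra.
by move/continuousP: cf; apply; exact: interval_open.
Qed.

Lemma setI_cylinder s t : (size s <= size t)%N ->
  cylinder s `&` cylinder t = cylinder t \/ cylinder s `&` cylinder t = set0.
Proof.
have prefix_drop x k n : prefix x n = drop k (prefix x (k + n)).
  by elim: k => //= ; rewrite ?drop0.
move=> st; have [E|E] := eqVneq (drop (size t - size s) t) s; [left|right].
  apply/setIidPr => x; rewrite /cylinder /= !in_cylinderE => /eqP xt.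
  by rewrite (prefix_drop _ (size t - size s)%N) subnK // xt E.
apply/seteqP; split=> // x [].
rewrite /cylinder /= !in_cylinderE (prefix_drop _ (size t - size s)%N) subnK //.
by move=> /eqP + /eqP xt; rewrite xt => /eqP; rewrite (negbTE E).
Qed.

(** Any two cylinders are nested or disjoint, so with the empty set they form a
    pi-system. *)
Lemma cylinder_measure_unique (R : realType)
    (mu nu : {measure set config -> \bar R}) :
  (mu setT < +oo)%E -> (forall t, mu (cylinder t) = nu (cylinder t)) ->
  forall A, measurable A -> mu A = nu A.
Proof.
move=> muT mn A mA.
pose G : set (set config) := [set C | C = set0 \/ exists t, C = cylinder t].
have T0 : (setT : set config) = cylinder [::] by apply/seteqP; split.
apply: (@measure_unique _ R _ G (fun=> setT)) => //.
- apply/seteqP; split; last first.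
    apply: smallest_sub; first exact: sigma_algebra_measurable.
    by move=> _ [->|[t ->]]; [exact: measurable0|exact: measurable_cylinder].
  apply: smallest_sub; first exact: smallest_sigma_algebra.
  move=> U oU; rewrite (open_bigcup_cylinder oU) bigcup_mkcond.
  have := @countable_bigcupT_measurable _ (g_sigma_algebraType G) (seq bool).
  apply; first exact: countableP.
  move=> t; case: ifP => _; last exact: measurable0.
  by apply: sub_sigma_algebra; right; exists t.
- move=> B C [->|[s ->]] [->|[t ->]]; rewrite ?set0I ?setI0; try by left.
  have [st|/ltnW ts] := leqP (size s) (size t).
    by case: (setI_cylinder st) => ->; [right; exists t|left].
  by rewrite setIC; case: (setI_cylinder ts) => ->; [right; exists s|left].
- by move=> _; right; exists [::].
- by rewrite bigcup_const.
- by move=> B [->|[t ->]]; rewrite ?measure0 ?mn.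
Qed.

(** * Measures with prescribed values on cylinders *)

Section quantile.
Variables (R : realType) (v : seq bool -> R).
Hypothesis v_ge0 : forall t, 0 <= v t.
Hypothesis v_nil : v [::] = 1.
Hypothesis v_cons : forall t, v (false :: t) + v (true :: t) = v t.

(** The unit interval is cut, in lexicographic order, into one interval of
    length v t for each word t of a given length. *)
Fixpoint left_end (t : seq bool) : R :=
  if t is a :: t' then left_end t' + (if a then v (false :: t') else 0) else 0.

Fixpoint quantile_word (u : R) n : seq bool :=
  if n is n'.+1 then
    let t := quantile_word u n' in (left_end t + v (false :: t) <= u) :: t
  else [::].

Definition quantile (u : measurableTypeR R) : config := fun n =>
  let t := quantile_word u n in left_end t + v (false :: t) <= u.

Lemma prefix_quantile u n : prefix (quantile u) n = quantile_word u n.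
Proof. by elim: n => //= n ->. Qed.

Lemma quantile_cylinder_cons a t :
  quantile @^-1` cylinder (a :: t) =
  quantile @^-1` cylinder t `&` [set u | (left_end t + v (false :: t) <= u) == a].
Proof.
apply/seteqP; split=> u; rewrite /preimage /cylinder /= in_cylinderE prefix_quantile.
  by move=> /andP[+ /eqP E]; rewrite /quantile E.
by case=> /eqP E; rewrite /quantile E eqxx andbT.
Qed.

Lemma quantile_cylinder_sub t u : 0 <= u <= 1 -> cylinder t (quantile u) ->
  left_end t <= u <= left_end t + v t.
Proof.
move=> u01; elim: t => [|a t ih]; first by rewrite /= add0r v_nil.
rewrite -[cylinder _ _]/((quantile @^-1` cylinder (a :: t)) u).
rewrite quantile_cylinder_cons => -[/ih /andP[l1 l2] /= /eqP <-].
have := v_cons t.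
case: (lerP (left_end t + v (false :: t)) u); lra.
Qed.

Lemma cylinder_quantile_sub t u :
  left_end t <= u < left_end t + v t -> cylinder t (quantile u).
Proof.
elim: t => [//|a t ih] /=.
rewrite -[cylinder _ _]/((quantile @^-1` cylinder (a :: t)) u).
rewrite quantile_cylinder_cons => /andP[l1 l2].
have := v_cons t; have := v_ge0 (false :: t); have := v_ge0 (true :: t) => v1 v0 vv.
split; first by apply: ih; case: a l1 l2; lra.
by case: a l1 l2 => l1 l2 /=; case: lerP => //; lra.
Qed.

Lemma left_end_bound t : 0 <= left_end t /\ left_end t + v t <= 1.
Proof.
elim: t => [|a t [l0 l1]] /=; first by rewrite v_nil; lra.
have := v_cons t; have := v_ge0 (false :: t); have := v_ge0 (true :: t).
by case: a; lra.
Qed.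

Lemma measurable_quantile : measurable_fun setT quantile.
Proof.
apply: measurable_fun_cylinder; elim=> [|a t mt].
  have -> : quantile @^-1` cylinder [::] = setT by apply/seteqP; split.
  exact: measurableT.
rewrite quantile_cylinder_cons; apply: measurableI => //.
case: a.
  have -> : [set u | (left_end t + v (false :: t) <= u) == true] =
      `[left_end t + v (false :: t), +oo[%classic.
    by apply/seteqP; split=> u /=; rewrite in_itv /= andbT => /eqP.
  exact: measurable_itv.
have -> : [set u | (left_end t + v (false :: t) <= u) == false] =
    `]-oo, left_end t + v (false :: t)[%classic.
  by apply/seteqP; split=> u /=; rewrite in_itv /= ltNge; case: (_ <= _).
exact: measurable_itv.
Qed.

HB.instance Definition _ := isMeasurableFun.Build _ _ _ _ quantile measurable_quantile.

(** The law of the quantile map of a uniform variable.  At the right end of the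
    unit interval the quantile map takes the value of the last interval, so its
    preimages are only sandwiched between half-open and closed intervals. *)
Lemma exists_cylinder_probability :
  exists mu : probability config R, forall t, mu (cylinder t) = (v t)%:E.
Proof.
exists (distribution (uniform_prob (@ltr01 R)) quantile) => t.
change (uniform_prob (@ltr01 R) (quantile @^-1` cylinder t) = (v t)%:E).
have mt : measurable (quantile @^-1` cylinder t).
  by rewrite -[X in measurable X]setTI; apply: measurable_quantile => //; exact: measurable_cylinder.
transitivity (lebesgue_measure (quantile @^-1` cylinder t `&` `[0, 1]%classic)).
  rewrite /uniform_prob integral_uniform_pdf (eq_integral (fun=> 1%:E)); last first.
    by move=> x; rewrite inE /= in_itv /= /uniform_pdf => -[_ ->]; rewrite subr0 invr1.
  by rewrite integral_cst ?mul1e //; exact: measurableI.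
have [l0 l1] := left_end_bound t.
have vt := v_ge0 t.
apply/eqP; rewrite eq_le; apply/andP; split.
  apply: (@le_trans _ _ (lebesgue_measure `[left_end t, left_end t + v t]%classic)).
    apply: le_measure; rewrite ?inE //; first exact: measurableI.
    by move=> u [ut /=]; rewrite !in_itv /= => u01; exact: quantile_cylinder_sub.
  rewrite lebesgue_measure_itv /= lte_fin ltrDl; case: ifP => _.
    by rewrite -EFinD addrAC subrr add0r.
  by rewrite lee_fin.
apply: (@le_trans _ _ (lebesgue_measure `[left_end t, left_end t + v t[%classic)).
  rewrite lebesgue_measure_itv /= lte_fin ltrDl; case: ifPn => [_|].
    by rewrite -EFinD addrAC subrr add0r.
  by rewrite -leNgt lee_fin.
apply: le_measure; rewrite ?inE //; first exact: measurableI.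
move=> u /=; rewrite in_itv /= => ut; split; first exact: cylinder_quantile_sub.
by rewrite /= in_itv /=; lra.
Qed.

End quantile.

(** * Stationary means on bounded observables *)

Section stationary_mean.
Variable R : realType.
Implicit Types (f g q : cantor_space -> R).

Definition bounded_obs f := exists C, forall x, `|f x| <= C.

Lemma transfer_bound q f (C : R) n x : is_kernel q -> (forall y, `|f y| <= C) ->
  `|iter n (transfer q) f x| <= C.
Proof.
move=> kq fC; rewrite ler_norml; apply: iter_transfer_bound => // y.
by rewrite -ler_norml.
Qed.

Lemma ultra_bounded_cvg (G : set_system nat) (u : nat -> R) C : UltraFilter G ->
  (forall n, `|u n| <= C) -> cvg (u @ G).
Proof.
move=> UG uC.
have uI : G (u @^-1` `[- C, C]%classic).
  by apply: filterE => n; rewrite /preimage /= in_itv /= -ler_norml.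
have [//|] := @segment_compact R (- C) C (u @ G).
move=> l [_ ul]; apply/cvg_ex; exists l => V Vl.
have [//|nV] := in_ultra_setVsetC (u @^-1` V) UG.
by have [y [/= ny]] := ul (~` V) V nV Vl.
Qed.

(** A cluster value of the time averages of the chain started at x0, taken along
    an ultrafilter so that it exists for all bounded observables at once. *)
Lemma exists_stationary_mean q (x0 : cantor_space) : is_kernel q ->
  exists Lam : (cantor_space -> R) -> R,
  [/\ forall f g a, bounded_obs f -> bounded_obs g ->
        Lam (fun x => a * f x + g x) = a * Lam f + Lam g,
      Lam (fun=> 1) = 1,
      forall f, bounded_obs f -> Lam (transfer q f) = Lam f
    & forall f a, bounded_obs f ->
        (forall n, a <= iter n (transfer q) f x0) -> a <= Lam f].
Proof.
move=> kq; have [G [UG sG]] := @ultraFilterLemma _ (\oo : set_system nat) _.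
pose A f n := (n.+1%:R)^-1 * \sum_(0 <= k < n.+1) iter k (transfer q) f x0.
have np n : 0 < (n.+1%:R)^-1 :> R by rewrite invr_gt0 ltr0n.
have n1 n (a : R) : (n.+1%:R)^-1 * (\sum_(0 <= k < n.+1) a) = a.
  by rewrite sumr_const_nat subn0 -[a *+ _]mulr_natl mulKf // pnatr_eq0.
have Acvg f : bounded_obs f -> cvg (A f @ G).
  move=> [C fC]; apply: (@ultra_bounded_cvg G _ C) => n.
  rewrite /A normrM gtr0_norm // -[leRHS](n1 n) ler_pM2l //.
  apply: le_trans (ler_norm_sum _ _ _) _; apply: ler_sum => k _.
  exact: transfer_bound.
exists (fun f => lim (A f @ G)); split.
- move=> f g a bf bg.
  have -> : A (fun x => a * f x + g x) = (fun n => a * A f n + A g n).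
    apply/funext => n; rewrite /A.
    under eq_bigr do rewrite iter_transfer_lin.
    by rewrite big_split /= -mulr_sumr mulrDr mulrCA.
  apply: cvg_lim => //; apply: cvgD; last exact: Acvg.
  apply: cvgZr; exact: Acvg.
- have -> : A (fun=> 1) = (fun=> 1).
    apply/funext => n; rewrite /A.
    under eq_bigr do rewrite iter_transfer_cst.
    exact: n1.
  by apply: cvg_lim => //; exact: cvg_cst.
- move=> f [C fC].
  have bf : bounded_obs f by exists C.
  have bLf : bounded_obs (transfer q f).
    by exists C => x; exact: (@transfer_bound q f C 1%N).
  apply/eqP; rewrite -subr_eq0; apply/eqP.
  rewrite -limB; [|exact: Acvg|exact: Acvg].
  apply: cvg_lim => //; apply: (@cvg_trans _ ((A (transfer q f) - A f) @ \oo)).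
    by move=> V; exact: sG.
  apply/cvgr0Pnorm_le => e e0; near=> n.
  have -> : (A (transfer q f) - A f) n =
      (n.+1%:R)^-1 * (iter n.+1 (transfer q) f x0 - f x0).
    rewrite /A -[LHS]/(_ * _ - _ * _) -mulrBr; congr (_ * _).
    under eq_bigr do rewrite -iterSr.
    by rewrite -sumrB (telescope_sumr (fun k => iter k (transfer q) f x0)).
  rewrite normrM gtr0_norm // ler_pdivrMl ?ltr0n //.
  apply: (@le_trans _ _ (2 * C)).
    apply: le_trans (ler_normB _ _) _.
    have := @transfer_bound q f C n.+1 x0 kq fC; have := fC x0; lra.
  rewrite -ler_pdivrMr //.
  apply: (@le_trans _ _ n%:R); last by rewrite ler_nat.
  near: n; exact: nbhs_infty_ger.
- move=> f a bf af; apply: limr_ge; first exact: Acvg.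
  near=> n; rewrite /A -[leLHS](n1 n) ler_pM2l //.
  by apply: ler_sum => k _; exact: af.
Unshelve. all: by end_near. Qed.

End stationary_mean.

(** * From a stationary mean to an invariant measure *)

Lemma in_cylinder_rcons t a x :
  in_cylinder (rcons t a) x = (x 0%N == a) && in_cylinder t (Tshift x).
Proof.
elim: t => [|b t ih]; first by rewrite /= andbT.
by rewrite /= ih size_rcons /Tshift andbCA.
Qed.

Lemma in_cylinder_concat t a b x :
  in_cylinder (rcons t a) (concat b x) = (b == a) && in_cylinder t x.
Proof. exact: in_cylinder_rcons. Qed.

Fixpoint word_point (t : seq bool) : cantor_space :=
  if t is a :: t' then fun i => if i == size t' then a else word_point t' i
  else fun=> true.

Lemma in_cylinder_word_point t : in_cylinder t (word_point t).
Proof.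
elim: t => //= a t ih; rewrite !eqxx /=.
move: ih; rewrite !in_cylinderE => /eqP ih; apply/eqP; rewrite -[RHS]ih.
by apply/prefix_eqP => i it; rewrite /= ltn_eqF.
Qed.

Lemma cylinder_prefix_eq t x y : cylinder t x -> cylinder t y ->
  prefix_eq (size t) x y.
Proof.
by rewrite /cylinder /= !in_cylinderE prefix_eqP => /eqP -> /eqP ->.
Qed.

Lemma measurable_Tshift : measurable_fun setT (Tshift : config -> config).
Proof.
apply: measurable_fun_cylinder => t.
have -> : (Tshift : config -> config) @^-1` cylinder t =
    cylinder (rcons t true) `|` cylinder (rcons t false).
  apply/seteqP; split=> x; rewrite /preimage /cylinder /= !in_cylinder_rcons.
    by move=> ->; case: (x 0%N); [left|right].
  by case=> /andP[].
by apply: measurableU; exact: measurable_cylinder.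
Qed.

Definition config_shift : config -> config := Tshift.

HB.instance Definition _ :=
  isMeasurableFun.Build _ _ config config config_shift measurable_Tshift.

Definition prefix_uniform (R : realType) (f : cantor_space -> R) :=
  forall e : R, 0 < e -> exists n, forall x y, prefix_eq n x y -> `|f x - f y| <= e.

Section mean_measure.
Variables (R : realType) (g : cantor_space -> R).
Variable Lam : (cantor_space -> R) -> R.
Local Notation q := (fun x => g (concat true x)).
Hypothesis gG : gfunction g.
Hypothesis g_uniform : prefix_uniform g.
Hypothesis Lam_linear : forall f h a, bounded_obs f -> bounded_obs h ->
  Lam (fun x => a * f x + h x) = a * Lam f + Lam h.
Hypothesis Lam_ge0 : forall f, bounded_obs f -> (forall x, 0 <= f x) -> 0 <= Lam f.
Hypothesis Lam1 : Lam (fun=> 1) = 1.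
Hypothesis Lam_stationary : forall f, bounded_obs f -> Lam (transfer q f) = Lam f.

Definition ind t x : R := (in_cylinder t x)%:R.

Lemma ind_cons t x : ind t x = ind (false :: t) x + ind (true :: t) x.
Proof.
by rewrite /ind /=; case: (x (size t)); case: (in_cylinder t x);
   rewrite ?addr0 ?add0r.
Qed.

Lemma bounded_indM t f : bounded_obs f -> bounded_obs (fun x => ind t x * f x).
Proof.
move=> [C fC]; exists C => x; rewrite /ind; case: in_cylinder; rewrite ?mul1r //.
by rewrite mul0r normr0; apply: le_trans (fC x).
Qed.

Lemma bounded_cst (a : R) : bounded_obs (fun=> a).
Proof. by exists `|a|. Qed.

Lemma bounded_ind t : bounded_obs (ind t).
Proof.
by exists 1 => x; rewrite /ind; case: in_cylinder; rewrite ?normr1 ?normr0.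
Qed.

Lemma Lam_add f h : bounded_obs f -> bounded_obs h ->
  Lam (fun x => f x + h x) = Lam f + Lam h.
Proof.
move=> bf bh; rewrite -[Lam f]mul1r -Lam_linear //; congr Lam.
by apply/funext => x; rewrite mul1r.
Qed.

Lemma Lam_scale f a : bounded_obs f -> Lam (fun x => a * f x) = a * Lam f.
Proof.
move=> bf.
have L0 : Lam (fun=> 0) = 0.
  have := Lam_add (bounded_cst 0) (bounded_cst 0).
  have -> : (fun _ : cantor_space => 0 + 0 : R) = (fun=> 0).
    by apply/funext => x; rewrite addr0.
  lra.
rewrite -[RHS]addr0 -[X in _ = _ + X]L0 -Lam_linear //; last exact: bounded_cst.
by congr Lam; apply/funext => x; rewrite addr0.
Qed.

Lemma Lam_le f h : bounded_obs f -> bounded_obs h -> (forall x, f x <= h x) ->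
  Lam f <= Lam h.
Proof.
move=> bf bh fh; rewrite -subr_ge0.
have -> : Lam h - Lam f = Lam (fun x => -1 * f x + h x).
  by rewrite Lam_linear //; ring.
apply: Lam_ge0; last by move=> x; have := fh x; lra.
have [C fC] := bf; have [D hD] := bh; exists (C + D) => x.
by rewrite mulN1r (le_trans (ler_normD _ _)) // normrN lerD.
Qed.

Lemma exists_mean_measure : exists mu : probability config R,
  forall t, mu (cylinder t) = (Lam (ind t))%:E.
Proof.
apply: (@exists_cylinder_probability R (fun t => Lam (ind t))).
- move=> t; apply: Lam_ge0; first exact: bounded_ind.
  by move=> x; rewrite /ind ler0n.
- by rewrite -Lam1; congr Lam; apply/funext => x; rewrite /ind.
- move=> t; rewrite -Lam_add; [|exact: bounded_ind|exact: bounded_ind].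
  by congr Lam; apply/funext => x; rewrite -ind_cons.
Qed.

Variable mu : probability config R.
Hypothesis mu_cylinder : forall t, mu (cylinder t) = (Lam (ind t))%:E.

(** The form that rewrites where mu has been coerced to a measure. *)
Let muE t : (mu : {measure set config -> \bar R}) (cylinder t) = (Lam (ind t))%:E.
Proof. exact: mu_cylinder. Qed.

(** On a cylinder where G oscillates little the two sides almost agree, as the
    integral and the mean both are positive; as both are additive, the
    difference on any cylinder is bounded by the sum over a fine partition. *)
Lemma integral_cylinder (G : cantor_space -> R) t : (forall x, 0 <= G x <= 1) ->
  prefix_uniform G ->
  (\int[mu]_(x in cylinder t) (G x)%:E = (Lam (fun x => ind t x * G x))%:E)%E.
Proof.
move=> G01 Gu.
have mG : measurable_fun setT (G : config -> R).
  by apply: continuous_measurable_config; exact: continuous_prefix.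
have mGE D : measurable_fun (D : set config) (EFin \o (G : config -> R)).
  by apply: measurable_funTS; exact/measurable_EFinP.
have bG : bounded_obs G.
  by exists 1 => x; have /andP[g0 g1] := G01 x; rewrite ger0_norm.
pose J s := fine (\int[mu]_(x in cylinder s) (G x)%:E)%E.
have JE s : (\int[mu]_(x in cylinder s) (G x)%:E = (J s)%:E)%E.
  rewrite /J fineK // ge0_fin_numE; last first.
    by apply: integral_ge0 => x _; rewrite lee_fin; have /andP[] := G01 x.
  apply: (@le_lt_trans _ _ (\int[mu]_(x in cylinder s) cst 1%:E x)%E).
    apply: ge0_le_integral => //; first exact: measurable_cylinder.
      by move=> x _; rewrite lee_fin; have /andP[] := G01 x.
    by move=> x _; rewrite lee_fin; have /andP[] := G01 x.
  rewrite integral_cst ?mul1e; last exact: measurable_cylinder.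
  by rewrite muE ltry.
rewrite JE; congr EFin.
pose K s := Lam (fun x => ind s x * G x).
suff close e : 0 < e -> `|J t - K t| <= 2 * e * Lam (ind t).
  apply/eqP; rewrite -subr_eq0 -normr_le0; apply/ler_addgt0Pr => e e0.
  have Lt : Lam (ind t) <= 1.
    rewrite -Lam1; apply: Lam_le; [exact: bounded_ind|exact: bounded_cst|].
    by move=> x; rewrite /ind lern1; case: in_cylinder.
  have L0 : 0 <= Lam (ind t).
    by apply: Lam_ge0; [exact: bounded_ind|move=> x; rewrite /ind ler0n].
  have e2 : 0 < e / 2 by rewrite divr_gt0.
  apply: le_trans (close _ e2) _; rewrite add0r mulrCA divff // mulr1.
  by rewrite ler_piMr // ltW.
move=> e0; have [n nG] := Gu e e0.
have : exists k, (n <= size t + k)%N by exists n; rewrite leq_addl.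
case=> k; elim: k t => [|k ih] t nt.
  rewrite addn0 in nt; set c := G (word_point t).
  have osc x : cylinder t x -> c - e <= G x <= c + e.
    move=> tx; have : `|G x - c| <= e.
      apply: nG => i ni; apply: (cylinder_prefix_eq tx (in_cylinder_word_point t)).
      exact: leq_trans nt.
    by rewrite ler_norml; lra.
  have bK a : bounded_obs (fun x => a * ind t x).
    by exists `|a| => x; rewrite /ind; case: in_cylinder; rewrite ?mulr1 // mulr0 normr0.
  have K1 : K t <= (c + e) * Lam (ind t).
    rewrite -Lam_scale; last exact: bounded_ind.
    apply: Lam_le => //; first exact: bounded_indM.
    move=> x; rewrite /ind; case: (boolP (in_cylinder t x)) => [/osc|_].
      by rewrite mul1r mulr1 => /andP[].
    by rewrite mul0r mulr0.
  have K2 : (c - e) * Lam (ind t) <= K t.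
    rewrite -Lam_scale; last exact: bounded_ind.
    apply: Lam_le => //; first exact: bounded_indM.
    move=> x; rewrite /ind; case: (boolP (in_cylinder t x)) => [/osc|_].
      by rewrite mul1r mulr1 => /andP[].
    by rewrite mul0r mulr0.
  have G0 x : (0 <= (G x)%:E)%E by rewrite lee_fin; have /andP[] := G01 x.
  have ce0 : 0 <= c + e by have /andP[c0 _] := G01 (word_point t); rewrite /c; lra.
  have mt := measurable_cylinder t.
  have J1 : J t <= (c + e) * Lam (ind t).
    rewrite -lee_fin -JE EFinM -muE -integral_cst //.
    apply: ge0_le_integral => //.
    by move=> x /osc /andP[_ ?]; rewrite lee_fin.
  have J0 : 0 <= J t by rewrite -lee_fin -JE; apply: integral_ge0.
  have L0 : 0 <= Lam (ind t).
    by apply: Lam_ge0; [exact: bounded_ind|move=> x; rewrite /ind ler0n].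
  have J2 : (c - e) * Lam (ind t) <= J t.
    have [ce|ce] := lerP 0 (c - e); last first.
      by apply: le_trans J0; rewrite nmulr_rle0.
    rewrite -lee_fin -JE EFinM -muE -integral_cst //.
    apply: ge0_le_integral => //.
    by move=> x /osc /andP[? _]; rewrite lee_fin.
  by rewrite ler_norml; lra.
have Jadd : J t = J (false :: t) + J (true :: t).
  have [mf mt] := (measurable_cylinder (false :: t), measurable_cylinder (true :: t)).
  apply: EFin_inj; rewrite EFinD -!JE -ge0_integral_setU //.
  - congr (integral _ _ _); apply/seteqP; split=> x; rewrite /cylinder /=.
      by move=> ->; case: (x (size t)); [right|left].
    by case=> /andP[].
  - by move=> x _; rewrite lee_fin; have /andP[] := G01 x.
  - apply/disj_setPS => x [] /=; rewrite /cylinder /=.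
    by move=> /andP[/eqP -> _] /andP[].
have Kadd : K t = K (false :: t) + K (true :: t).
  rewrite /K -Lam_add; [|exact: bounded_indM|exact: bounded_indM].
  by congr Lam; apply/funext => x; rewrite ind_cons mulrDl.
have Ladd : Lam (ind t) = Lam (ind (false :: t)) + Lam (ind (true :: t)).
  rewrite -Lam_add; [|exact: bounded_ind|exact: bounded_ind].
  by congr Lam; apply/funext => x; rewrite ind_cons.
have := ih (false :: t); have := ih (true :: t).
rewrite /= addSnnS => /(_ nt) h1 /(_ nt) h2.
rewrite Jadd Kadd Ladd opprD addrACA mulrDr.
by apply: le_trans (ler_normD _ _) _; exact: lerD.
Qed.

Lemma g_concat_sum x : g (concat false x) = 1 - g (concat true x).
Proof. by have [_ _ /(_ x)] := gG; rewrite big_bool /=; lra. Qed.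

Lemma Lam_rcons t a :
  Lam (ind (rcons t a)) = Lam (fun x => ind t x * g (concat a x)).
Proof.
rewrite -Lam_stationary; last exact: bounded_ind.
congr Lam; apply/funext => x.
rewrite /transfer /ind !in_cylinder_concat.
by case: a; case: in_cylinder; rewrite /= ?g_concat_sum; ring.
Qed.

Lemma mean_measure_invariant (B : set config) : measurable B -> mu (Tshift @^-1` B) = mu B.
Proof.
move=> mB; have := @cylinder_measure_unique R (distribution mu config_shift) mu.
apply => //.
  by rewrite (le_lt_trans (probability_le1 _ _)) // ltry.
move=> t; rewrite -[LHS]/(mu (Tshift @^-1` cylinder t)) muE.
have -> : (Tshift : config -> config) @^-1` cylinder t =
    cylinder (rcons t true) `|` cylinder (rcons t false).
  apply/seteqP; split=> x; rewrite /preimage /cylinder /= !in_cylinder_rcons.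
    by move=> ->; case: (x 0%N); [left|right].
  by case=> /andP[].
rewrite measureU; [|exact: measurable_cylinder|exact: measurable_cylinder|].
  transitivity ((Lam (ind (rcons t true)))%:E + (Lam (ind (rcons t false)))%:E)%E.
    by congr (_ + _)%E; exact: mu_cylinder.
  rewrite -EFinD !Lam_rcons -Lam_add; last 2 first.
  - by apply: bounded_indM; exists 1 => x; have [_ /(_ (concat true x)) g01 _] := gG;
       rewrite gtr0_norm; lra.
  - by apply: bounded_indM; exists 1 => x; have [_ /(_ (concat false x)) g01 _] := gG;
       rewrite gtr0_norm; lra.
  congr EFin; congr Lam; apply/funext => x; rewrite g_concat_sum; ring.
apply/seteqP; split=> // x []; rewrite /cylinder /= !in_cylinder_rcons.
by move=> /andP[/eqP ->].
Qed.

(** By invariance the conditional probability identity reduces to an equality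
    between two measures of the event B, one with density G and one that counts
    the letter a at 0; stationarity of the mean gives it on cylinders. *)
Lemma mean_measure_gmeasure : gmeasure g mu.
Proof.
split=> // [|a]; first exact: mean_measure_invariant.
pose G (x : config) : R := g (concat a x).
have Gu : prefix_uniform G.
  move=> e e0; have [n gn] := g_uniform e0; exists n => x y xy; apply: gn.
  by move=> [|i] // ni; apply: xy; exact: ltnW.
have G01 x : 0 <= G x <= 1.
  by have [_ /(_ (concat a x)) g01 _] := gG; rewrite /G; lra.
have mG : measurable_fun setT G.
  by apply: continuous_measurable_config; exact: continuous_prefix.
have hE : (fun x => g (subst0 a x)) = G \o Tshift.
  by apply/funext => x; rewrite /G /=; congr g; apply/funext => -[].
rewrite hE; split.
  move=> Y mY; exists (G @^-1` Y); last by rewrite setTI.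
  by rewrite -[X in measurable X]setTI; exact: mG.
move=> _ [B mB <-]; rewrite setTI.
have mGE : measurable_fun setT (EFin \o G) by exact/measurable_EFinP.
have G0 x : (0 <= (EFin \o G) x)%E by rewrite lee_fin; have /andP[] := G01 x.
rewrite -[LHS]/(\int[mu]_(x in Tshift @^-1` B) ((EFin \o G) \o Tshift) x)%E.
have -> : (\int[mu]_(x in Tshift @^-1` B) ((EFin \o G) \o Tshift) x =
    \int[distribution mu config_shift]_(x in B) (EFin \o G) x)%E.
  rewrite (ge0_integral_pushforward measurable_Tshift) //.
  exact: measurable_funTS.
rewrite (eq_measure_integral mu); last first.
  by move=> A mA _; exact: mean_measure_invariant.
pose C : set config := cylinder [:: a].
have -> : [set x : config | x 0%N = a] = C.
  apply/seteqP; split=> x; rewrite /C /cylinder /= andbT.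
    by move=> ->.
  by move=> /eqP.
have mC : measurable C by exact: measurable_cylinder.
pose m2 := fun D : set config => (\int[mu]_(x in D) (EFin \o G) x)%E.
have m20 : m2 set0 = 0%E by rewrite /m2 integral_set0.
have m2ge0 D : (0 <= m2 D)%E by apply: integral_ge0 => x _; exact: G0.
have m2s : semi_sigma_additive m2.
  move=> F mF tF mUF; rewrite /m2; apply: cvg_toP.
    apply: ereal_nondecreasing_is_cvgn => i j ij.
    by apply: lee_sum_nneg_natr => // k _ _; exact: m2ge0.
  rewrite ge0_integral_bigcup //; exact: measurable_funTS.
pose M2 : {measure set config -> \bar R} :=
  HB.pack m2 (isMeasure.Build _ _ _ m2 m20 m2ge0 m2s).
suff -> : (\int[mu]_(y in B) (EFin \o G) y)%E =
    pushforward (mrestr mu mC) config_shift B by rewrite setIC.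
rewrite -[LHS]/(M2 B).
apply: cylinder_measure_unique => //.
  rewrite -[X in (X < _)%E]/(\int[mu]_(x in setT) (EFin \o G) x)%E.
  apply: (@le_lt_trans _ _ (\int[mu]_(x in setT) cst 1%:E x)%E).
    by apply: ge0_le_integral => // x _; rewrite lee_fin; have /andP[] := G01 x.
  by rewrite integral_cst // mul1e (le_lt_trans (probability_le1 _ _)) // ltry.
move=> t.
rewrite -[LHS]/(\int[mu]_(x in cylinder t) (G x)%:E)%E integral_cylinder //.
rewrite -Lam_rcons -muE.
rewrite -[RHS]/(mu (Tshift @^-1` cylinder t `&` C)); congr (mu _).
apply/seteqP; split=> x; rewrite /C /cylinder /preimage /= in_cylinder_rcons andbT.
  by move=> /andP[].
by case=> -> ->.
Qed.

End mean_measure.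

(** * The scales and their weights *)

Section scales.
Variables (R : realType) (c : R) (m b : nat -> nat) (lam : nat -> R).
Hypothesis c_ge8 : 8 <= c.
Hypothesis m_odd : forall j : nat, (1 <= j)%N -> odd (m j).
Hypothesis m_def : forall j : nat, (1 <= j)%N ->
  (m j)%:R = 2 `^ (c * j%:R ^+ 2) - 1 :> R.
Hypothesis b1 : b 1%N = 1%N.
Hypothesis b_def : forall l : nat, (2 <= l)%N ->
  (b l)%:R = 2 `^ ((c * \sum_(1 <= j < l) (b j)%:R) ^+ 2) :> R.
Hypothesis lam_def : forall l j : nat, (1 <= l)%N ->
  (\sum_(1 <= k < l) b k + 1 <= j <= \sum_(1 <= k < l.+1) b k)%N ->
  lam j = (3 / 4) ^+ (l - 1)%N / (4 * (b l)%:R).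

Definition block_end l : nat := \sum_(1 <= k < l.+1) b k.

(** Blocks are counted from 1: this is the weight of the scales j such that
    block_end l < j <= block_end l.+1. *)
Definition block_weight l : R := (3 / 4) ^+ l / 4.

Local Notation B := block_end.
Local Notation w := block_weight.

Lemma powR2_le (x y : R) : x <= y -> 2 `^ x <= 2 `^ y.
Proof. by move=> xy; rewrite ler_powR //; lra. Qed.

Lemma block_end0 : B 0 = 0%N. Proof. by rewrite /B big_geq. Qed.
Lemma block_end1 : B 1 = 1%N. Proof. by rewrite /B big_nat1. Qed.
Lemma block_endS l : B l.+1 = (B l + b l.+1)%N.
Proof. by rewrite /B big_nat_recr. Qed.

Lemma m_powR j : (1 <= j)%N -> (m j).+1%:R = 2 `^ (c * j%:R ^+ 2) :> R.
Proof. by move=> j1; rewrite -natr1 m_def // subrK. Qed.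

Lemma m_lower j : (1 <= j)%N -> (2 ^ (8 * j ^ 2) <= (m j).+1)%N.
Proof.
move=> j1; rewrite -(ler_nat R) m_powR // natrX -(@powR_mulrn _ 2) //.
apply: powR2_le; rewrite natrM natrX ler_wpM2r //; exact: sqr_ge0.
Qed.

Lemma m_mono i j : (1 <= i)%N -> (i <= j)%N -> (m i <= m j)%N.
Proof.
move=> i1 ij; have j1 := leq_trans i1 ij.
rewrite -ltnS -(ler_nat R) !m_powR //; apply: powR2_le.
have c0 : 0 <= c by move: c_ge8; lra.
by rewrite ler_wpM2l // ler_pXn2r ?nnegrE ?ler0n // ler_nat.
Qed.

Lemma m_ge j : (1 <= j)%N -> (8 * j <= m j)%N.
Proof.
move=> j1; have := m_lower j1.
have : (8 * j < 2 ^ (8 * j))%N by exact: ltn_expl.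
have : (2 ^ (8 * j) <= 2 ^ (8 * j ^ 2))%N by rewrite leq_exp2l //; nia.
lia.
Qed.

Lemma b_lower l : (1 <= l)%N -> (1 <= B l)%N ->
  ((m (B l)).+1 ^ 8 <= b l.+1)%N.
Proof.
move=> l1 B1; rewrite -(ler_nat R) b_def //.
have -> : \sum_(1 <= j < l.+1) (b j)%:R = (B l)%:R :> R by rewrite natr_sum.
rewrite natrX m_powR // -(@powR_mulrn _ (2 `^ _)) ?powR_ge0 // -powRrM.
apply: powR2_le; rewrite exprMn.
have : 0 <= ((B l)%:R : R) ^+ 2 by exact: sqr_ge0.
move: ((B l)%:R ^+ 2) c_ge8 => s c8 s0.
have : 0 <= (c - 8) * (c * s) by rewrite !mulr_ge0 //; lra.
lra.
Qed.

Lemma block_end_ge1 l : (1 <= l)%N -> (1 <= B l)%N.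
Proof.
case: l => // l _; elim: l => [|l ih]; first by rewrite block_end1.
by rewrite block_endS (leq_trans ih) // leq_addr.
Qed.

Lemma b_ge l : (1 <= l)%N -> (24 * m (B l) <= b l.+1)%N.
Proof.
move=> l1; have B1 := block_end_ge1 l1.
have := m_ge B1; have := b_lower l1 B1; set M := m (B l).
have : (M.+1 * (M.+1 * M.+1) <= M.+1 ^ 8)%N.
  by rewrite !expnS leq_mul2l leq_mul2l /= leq_pmulr // ?muln_gt0 ?expn_gt0.
nia.
Qed.

Lemma b_gt0 l : (1 <= l)%N -> (0 < b l)%N.
Proof.
case: l => // -[|l] _; first by rewrite b1.
have := b_lower (isT : (1 <= l.+1)%N) (block_end_ge1 (isT : (1 <= l.+1)%N)).
by apply: leq_trans; rewrite expn_gt0.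
Qed.

Lemma block_end_mono i j : (i <= j)%N -> (B i <= B j)%N.
Proof.
by move=> ij; rewrite -(subnK ij); elim: (j - i)%N => // n ih;
   rewrite addSn block_endS (leq_trans ih) // leq_addr.
Qed.

Lemma block_end_ge l : (l <= B l)%N.
Proof.
elim: l => // l ih; rewrite block_endS.
have := b_gt0 (isT : (1 <= l.+1)%N); lia.
Qed.

Lemma exists_block j : (1 <= j)%N -> exists l, (B l < j <= B l.+1)%N.
Proof.
move=> j1; have : exists l, (j <= B l)%N by exists j; exact: block_end_ge.
case/ex_minnP => -[|l] jl lmin.
  by move: jl; rewrite block_end0; lia.
by exists l; rewrite jl andbT ltnNge; apply/negP => /lmin; rewrite ltnn.
Qed.

Lemma lam_block l j : (B l < j <= B l.+1)%N -> lam j = w l / (b l.+1)%:R.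
Proof.
move=> jl; rewrite (lam_def (isT : (1 <= l.+1)%N)); last by rewrite addn1.
by rewrite subn1 /= /w invfM mulrA.
Qed.

Lemma block_weight_gt0 l : 0 < w l.
Proof. by rewrite /w divr_gt0 // exprn_gt0 //; lra. Qed.

Lemma lam_ge0 j : (1 <= j)%N -> 0 <= lam j.
Proof.
move=> /exists_block[l jl]; rewrite (lam_block jl).
by rewrite divr_ge0 ?ler0n // ltW // block_weight_gt0.
Qed.

Lemma sum_lam_block l : \sum_((B l).+1 <= j < (B l.+1).+1) lam j = w l.
Proof.
rewrite (eq_big_nat _ _ (F2 := fun=> w l / (b l.+1)%:R)); last first.
  by move=> j /andP[j1 j2]; apply: lam_block; rewrite j1 -ltnS.
rewrite sumr_const_nat subSS block_endS addKn -[LHS]mulr_natr mulfVK //.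
by rewrite pnatr_eq0 -lt0n b_gt0.
Qed.

Lemma block_weightE l : w l = (3 / 4) ^+ l - (3 / 4) ^+ l.+1.
Proof. by rewrite /w exprS; lra. Qed.

Lemma sum_block_weight l L : (l <= L)%N ->
  \sum_(l <= i < L) w i = (3 / 4) ^+ l - (3 / 4) ^+ L.
Proof.
move=> lL; under eq_bigr do rewrite block_weightE -opprB.
by rewrite sumrN telescope_sumr // opprB.
Qed.

Lemma sum_blocks (F : nat -> R) l L : (l <= L)%N ->
  \sum_((B l).+1 <= j < (B L).+1) F j =
  \sum_(l <= i < L) \sum_((B i).+1 <= j < (B i.+1).+1) F j.
Proof.
move=> lL; rewrite -(subnK lL); elim: (L - l)%N => [|n ih].
  by rewrite add0n !big_geq.
rewrite addSn [RHS]big_nat_recr ?leq_addl //= -ih.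
by rewrite -big_cat_nat //= ltnS block_end_mono ?leq_addl.
Qed.

Lemma sum_lam L : \sum_(1 <= j < (B L).+1) lam j = 1 - (3 / 4) ^+ L.
Proof.
have := @sum_blocks lam 0 L isT; rewrite block_end0 => ->.
under eq_bigr do rewrite sum_lam_block.
by rewrite sum_block_weight // expr0.
Qed.

(** All scales of a block have the same weight, and there are at least 24 M of
    them if M is the longest earlier scale, so that those below 4 M weigh at
    most a sixth of the block. *)
Lemma sum_lam_short l : (1 <= l)%N ->
  \sum_((B l).+1 <= j < (B l.+1).+1 | ~~ (4 * m (B l) <= j)%N) lam j <= w l / 6.
Proof.
move=> l1.
have bp : 0 < (b l.+1)%:R :> R by rewrite ltr0n b_gt0.
apply: (@le_trans _ _ (\sum_(0 <= j < 4 * m (B l)) w l / (b l.+1)%:R)).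
  rewrite big_nat_cond (eq_bigr (fun=> w l / (b l.+1)%:R)); last first.
    by move=> j /andP[/andP[j1 j2] _]; apply: lam_block; rewrite j1 -ltnS.
  rewrite !big_const_seq !iter_addr_0.
  apply: ler_wpMn2l.
    by rewrite divr_ge0 ?ler0n // ltW // block_weight_gt0.
  rewrite -!size_filter; apply: uniq_leq_size.
    by rewrite filter_uniq // iota_uniq.
  move=> j; rewrite !mem_filter -ltnNge => /andP[/andP[_ jM] _].
  by rewrite mem_index_iota.
rewrite sumr_const_nat subn0 -[leLHS]mulr_natr mulrAC ler_pdivrMr //.
have wp := block_weight_gt0 l.
have : (4 * m (B l))%:R * 6 <= (b l.+1)%:R :> R.
  by rewrite -natrM ler_nat; have := b_ge l1; lia.
set x := (_ * _)%:R; set y := (b _)%:R => xy.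
have : w l * (x * 6) <= w l * y by rewrite ler_pM2l.
lra.
Qed.

Local Notation minority := (@minority R).
Local Notation field := (field m lam).

(** The part of the blocks l+2, ..., L that is on the wrong side although its
    scales are long enough for the large deviation estimate. *)
Definition long_minority l L (x : cantor_space) : R :=
  \sum_(l.+1 <= i < L) \sum_((B i).+1 <= j < (B i.+1).+1 | (4 * m (B i) <= j)%N)
     lam j * minority (m j) x.

Lemma long_minority_ge0 l L x : 0 <= long_minority l L x.
Proof.
apply: sumr_ge0 => i _; rewrite big_nat_cond; apply: sumr_ge0 => j.
move=> /andP[/andP[j1 _] _]; apply: mulr_ge0.
  by apply: lam_ge0; exact: leq_ltn_trans j1.
by have /andP[] := minority01 R (m j) x.
Qed.

(** The blocks after the (l+1)-st weigh three times as much as it does.  If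
    their long scales are positive, the short ones cancel at most a third of
    that, which leaves twice the weight of the (l+1)-st block; even when the
    whole of that block is negative, a bias of its weight remains. *)
Lemma field_lower l L x : (l < L)%N ->
  field (B l) x + w l - (3 / 4) ^+ L - 2 * long_minority l L x <= field (B L) x.
Proof.
move=> lL.
have split N N' : (N <= N')%N -> field (B N') x = field (B N) x +
    \sum_((B N).+1 <= j < (B N').+1) lam j * majority R (m j) x.
  by move=> NN; rewrite /field (@big_cat_nat _ _ _ (B N).+1) //= ltnS block_end_mono.
rewrite (split l.+1 L) // (split l l.+1) //.
have E1 : - w l <= \sum_((B l).+1 <= j < (B l.+1).+1) lam j * majority R (m j) x.
  rewrite -sum_lam_block -sumrN; apply: ler_sum_nat => j /andP[j1 _].
  have := lam_ge0 (leq_ltn_trans (leq0n _) j1).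
  have /andP[] := majority_bound R (m j) x; nra.
have E2 : 2 * w l - (3 / 4) ^+ L - 2 * long_minority l L x <=
    \sum_((B l.+1).+1 <= j < (B L).+1) lam j * majority R (m j) x.
  rewrite sum_blocks // /long_minority.
  apply: (@le_trans _ _ (\sum_(l.+1 <= i < L) (2 / 3 * w i - 2 *
    \sum_((B i).+1 <= j < (B i.+1).+1 | (4 * m (B i) <= j)%N) lam j * minority (m j) x))).
    rewrite sumrB -!mulr_sumr sum_block_weight // exprS /w.
    have : 0 <= (3 / 4 : R) ^+ L by apply: exprn_ge0; lra.
    lra.
  apply: ler_sum_nat => i /andP[i1 _].
  have i0 : (1 <= i)%N by exact: leq_ltn_trans i1.
  have short := sum_lam_short i0.
  rewrite [leRHS](bigID (fun j => (4 * m (B i) <= j)%N)) /=.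
  have := sum_lam_block i; rewrite (bigID (fun j => (4 * m (B i) <= j)%N)) /=.
  move: short; set S := \sum_(_ <= j < _ | ~~ _) lam j; set G := \sum_(_ <= j < _ | _) lam j.
  set N := \sum_(_ <= j < _ | _) _ * minority _ _ => short tot.
  have g1 : G - 2 * N <= \sum_((B i).+1 <= j < (B i.+1).+1 | (4 * m (B i) <= j)%N)
      lam j * majority R (m j) x.
    rewrite le_eqVlt; apply/orP; left; apply/eqP.
    under [RHS]eq_bigr => j _ do
      rewrite /majority mulrBr mulr1 mulrCA.
    by rewrite sumrB -mulr_sumr.
  have g2 : - S <= \sum_((B i).+1 <= j < (B i.+1).+1 | ~~ (4 * m (B i) <= j)%N)
      lam j * majority R (m j) x.
    rewrite /S -sumrN big_nat_cond [leRHS]big_nat_cond.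
    apply: ler_sum => j /andP[/andP[j1 _] _].
    have := lam_ge0 (leq_ltn_trans (leq0n _) j1).
    have /andP[] := majority_bound R (m j) x; nra.
  lra.
lra.
Qed.

Lemma long_scale_numeric l j : (1 <= l)%N -> (4 * m (B l) <= j)%N ->
  (2 ^ 12 * (2 * 4 ^ l.+1 * 4 ^ m (B l) * m (B l)) ^ 2 * (4 ^ l.+1) ^ 2
    * 2 ^ (j + 2) <= m j)%N.
Proof.
move=> l1 jM; have B1 := block_end_ge1 l1.
have lB := block_end_ge l; have mB := m_ge B1.
set M := m (B l) in jM mB *.
have M2 : (M <= 2 ^ M)%N by apply: ltnW; exact: ltn_expl.
have j1 : (1 <= j)%N by lia.
have mj : (2 ^ (8 * j ^ 2 - 1) <= m j)%N.
  have := m_lower j1; have -> : (8 * j ^ 2 = (8 * j ^ 2 - 1).+1)%N by nia.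
  rewrite expnS; set p := (2 ^ (_ - _))%N.
  have : (0 < p)%N by rewrite expn_gt0.
  rewrite subn1 /=; lia.
apply: leq_trans mj.
apply: (@leq_trans (2 ^ 12 * (2 * 2 ^ (2 * l.+1) * 2 ^ (2 * M) * 2 ^ M) ^ 2
   * (2 ^ (2 * l.+1)) ^ 2 * 2 ^ (j + 2))).
  rewrite !(expnM 2 2) leq_mul2r; apply/orP; right.
  rewrite leq_mul2r; apply/orP; right.
  by rewrite leq_mul2l leq_exp2r // leq_mul2l M2 orbT.
have -> : (2 * 2 ^ (2 * l.+1) * 2 ^ (2 * M) * 2 ^ M =
    2 ^ (1 + 2 * l.+1 + 2 * M + M))%N by rewrite !expnD expn1.
rewrite -!expnM -!expnD leq_exp2l //.
nia.
Qed.


(** * Persistence of the majority at all scales *)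

Local Notation plus := (plus : cantor_space).

Lemma exists_small (e : R) l : 0 < e -> exists2 L, (l < L)%N & (3 / 4) ^+ L <= e.
Proof.
move=> e0; pose n := (Num.trunc (4 / e)).+1.
have ne : 4 / e < n%:R by exact: truncnS_gt.
exists (n + l.+1)%N; first by rewrite ltn_addl.
apply: (@le_trans _ _ ((3 / 4) ^+ n)).
  rewrite exprD ler_piMr ?exprn_ge0 ?exprn_ile1 //; lra.
have := @bernoulli_decay R (1 / 4) n ltac:(lra) isT.
have -> : 1 - 1 / 4 = 3 / 4 :> R by lra.
move=> /le_trans; apply.
rewrite -[e]invrK lef_pV2 ?posrE ?invr_gt0 ?mulr_gt0 ?ltr0n //; lra.
Qed.

Section persistence.
Variable h : cantor_space -> R.
Hypothesis h_field : forall L x, `|h x - field (B L) x| <= (3 / 4) ^+ L.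

Definition drift_kernel x : R := 1 / 2 + h x / 4.

Lemma drift_kernel_bound x : 1 / 4 <= drift_kernel x <= 3 / 4.
Proof.
have := h_field 0 x; rewrite block_end0 /field big_geq // expr0 subr0.
by rewrite ler_norml /drift_kernel => /andP[h0 h1]; lra.
Qed.

Lemma drift_kernel_is_kernel : is_kernel drift_kernel.
Proof. by move=> x; have := drift_kernel_bound x; lra. Qed.

Lemma h_lower l L x : (l < L)%N ->
  field (B l) x + w l - 2 * (3 / 4) ^+ L - 2 * long_minority l L x <= h x.
Proof.
move=> lL; have := field_lower  x lL.
by have := h_field L x; rewrite ler_norml => /andP[h0 h1]; lra.
Qed.

Definition long_scale l j := (B l < j <= B l.+1)%N && (4 * m (B l) <= j)%N.

Lemma long_minority_iter n l L :
  (forall i j, (l < i)%N -> long_scale i j ->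
     iter n (transfer drift_kernel) (minority (m j)) plus <= (1 / 2) ^+ j) ->
  iter n (transfer drift_kernel) (long_minority l L) plus <= (1 / 2) ^+ (4 * m (B l.+1)).
Proof.
move=> small.
rewrite iter_transfer_sum.
set e := _ ^+ _; have e0 : 0 <= e by apply: exprn_ge0; lra.
apply: (@le_trans _ _ (\sum_(l.+1 <= i < L) w i * e)).
  apply: ler_sum_nat => i /andP[li _].
  rewrite iter_transfer_sum -sum_lam_block.
  rewrite mulr_suml [leRHS](bigID (fun j => (4 * m (B i) <= j)%N)) /=.
  rewrite -[leLHS]addr0; apply: lerD; last first.
    rewrite big_nat_cond sumr_ge0 // => j /andP[/andP[j1 _] _].
    rewrite mulr_ge0 // lam_ge0 //.
    exact: leq_ltn_trans j1.
  rewrite big_nat_cond [leRHS]big_nat_cond.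
  apply: ler_sum => j /andP[/andP[j1 j2] j3].
  rewrite iter_transferZ; apply: ler_wpM2l.
    apply: lam_ge0; exact: leq_ltn_trans j1.
  apply: le_trans (small i j li _) _; first by rewrite /long_scale j1 -ltnS j2.
  apply: ler_wiXn2l; [lra|lra|].
  apply: leq_trans j3; rewrite leq_mul2l /= m_mono //.
    by rewrite block_end_ge1.
  exact: block_end_mono.
have [lL|Ll] := leqP l.+1 L; last by rewrite big_geq // ltnW.
rewrite -mulr_suml sum_block_weight // ler_piMl //.
have : (3 / 4 : R) ^+ l.+1 <= 1 by rewrite exprn_ile1 //; lra.
have : 0 <= (3 / 4 : R) ^+ L by apply: exprn_ge0; lra.
lra.
Qed.

(** The dynamics of the first l blocks, with a bias in place of all the others,
    relaxes within a time of order 4^M, where M is its memory, while a long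
    scale m_j of the next block is at least 2^(8 j^2) - 1 with j >= 4 M. *)
Lemma long_scale_deviation l j x : (1 <= l)%N -> long_scale l j ->
  iter (m j) (transfer (biased m lam (B l) (w l))) (minority (m j)) x
  <= (1 / 2) ^+ (j + 2).
Proof.
move=> l1 /andP[jl jM].
have B1 := block_end_ge1  l1.
have lB := block_end_ge  l.
have mB := m_ge B1.
have w0 := block_weight_gt0 l.
(* As w l >= 4^-(l+1), this makes 4^M / k at most half of the bias. *)
pose k := (2 * 4 ^ l.+1 * 4 ^ m (B l))%N.
have num := long_scale_numeric l1 jM; rewrite -/k in num.
have k0 : (0 < k)%N by rewrite /k !muln_gt0 !expn_gt0.
have M0 : (0 < m (B l))%N by lia.
have mj0 : (0 < m j)%N.
  by apply: leq_trans num; rewrite !(muln_gt0, expn_gt0) M0.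
have wP : 1 <= w l * (4 ^ l.+1)%:R.
  rewrite /w natrX mulrAC exprS mulrCA -mulrA -exprMn.
  have -> : 3 / 4 * 4 = 3 :> R by lra.
  have : 1 <= (3 : R) ^+ l by apply: exprn_ege1; lra.
  lra.
have kw : 2 * 4 ^+ m (B l) <= w l * k%:R.
  rewrite /k !natrM [(4 ^ m (B l))%:R]natrX.
  set P := (4 ^ _)%:R in wP *; set Q : R := 4 ^+ _.
  have Q0 : 0 <= Q by apply: exprn_ge0.
  have := ler_wpM2r Q0 wP; lra.
have lamle : \sum_(1 <= i < (B l).+1) lam i + w l <= 1.
  rewrite sum_lam /w.
  have : 0 <= (3 / 4 : R) ^+ l by apply: exprn_ge0; lra.
  lra.
have dev := @biased_deviation R m lam (B l) (m (B l))
  lam_ge0 m_odd.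
have mle i : (1 <= i <= B l)%N -> (m i <= m (B l))%N.
  by move=> /andP[i1 iB]; apply: m_mono.
apply: le_trans (dev mle (w l) w0 lamle k (m j) x k0 M0 mj0 kw) _.
have mjp : 0 < (m j)%:R :> R by rewrite ltr0n.
rewrite ler_pdivrMr; last by rewrite mulr_gt0 // exprn_gt0 // divr_gt0.
rewrite -(ler_pM2r (_ : 0 < 2 ^+ (j + 2) * (4 ^ l.+1)%:R ^+ 2 * 16)); last first.
  by rewrite !mulr_gt0 // exprn_gt0 // ltr0n expn_gt0.
set P := (4 ^ l.+1)%:R in wP *.
set A := (k * m (B l))%N in num *.
have A1 : 1 <= A%:R :> R by rewrite (ler_nat R 1) muln_gt0 k0.
have num' : 2 ^+ 12 * A%:R ^+ 2 * P ^+ 2 * 2 ^+ (j + 2) <= (m j)%:R :> R.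
  move: num; rewrite /P; clearbody A; move: {A1} A (4 ^ l.+1)%N => A' P'.
  by rewrite -(ler_nat R) !(natrX, natrM).
have E : (1 / 2) ^+ (j + 2) * 2 ^+ (j + 2) = 1 :> R.
  by rewrite -exprMn (_ : 1 / 2 * 2 = 1) ?expr1n //; lra.
apply: (@le_trans _ _ (m j)%:R); last first.
  have -> : (1 / 2) ^+ (j + 2) * ((w l / 4) ^+ 2 * (m j)%:R) *
     (2 ^+ (j + 2) * P ^+ 2 * 16) = (w l * P) ^+ 2 * (m j)%:R *
     ((1 / 2) ^+ (j + 2) * 2 ^+ (j + 2)) by field.
  by rewrite E mulr1; apply: ler_peMl; [exact: ltW|exact: exprn_ege1].
apply: le_trans num'.
have -> : 16 * (1 + 2 * A%:R) ^+ 2 * (2 ^+ (j + 2) * P ^+ 2 * 16) =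
  2 ^+ 8 * (1 + 2 * A%:R) ^+ 2 * P ^+ 2 * 2 ^+ (j + 2) by ring.
have -> : 2 ^+ 12 * A%:R ^+ 2 * P ^+ 2 * 2 ^+ (j + 2) =
  2 ^+ 8 * (4 * A%:R) ^+ 2 * P ^+ 2 * 2 ^+ (j + 2) by ring.
rewrite ler_wpM2r ?exprn_ge0 // ler_wpM2r ?sqr_ge0 // ler_wpM2l ?exprn_ge0 //.
by rewrite ler_pXn2r // ?nnegrE; lra.
Qed.

(** Over a window of the length of the scale, compare with the dynamics of the
    earlier blocks plus a bias: the comparison costs something only where a
    long scale of a later block sees a minority, at an earlier time, whence the
    induction on time.  The cost is the length of the window times 2^(-4 M'),
    with M' the longest scale of the block of j. *)
Lemma long_scale_persistence n l j : (1 <= l)%N -> long_scale l j ->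
  iter n (transfer drift_kernel) (minority (m j)) plus <= (1 / 2) ^+ j.
Proof.
elim/ltn_ind: n l j => n ih l j l1 lj.
have kk := drift_kernel_is_kernel.
have w0 := block_weight_gt0 l.
have lamle : \sum_(1 <= i < (B l).+1) lam i + w l <= 1.
  rewrite sum_lam /w.
  have : 0 <= (3 / 4 : R) ^+ l by apply: exprn_ge0; lra.
  lra.
have lam0 := lam_ge0 .
set qY := biased m lam (B l) (w l).
have kY : is_kernel qY.
  by apply: (biased_is_kernel m lam0 lamle); lra.
have mY : nondecr qY by exact: nondecr_biased.
set f := minority (m j).
have f01 x : 0 <= f x <= 1 by exact: minority01.
have fN : nondecr (fun x => - f x) by exact: nondecr_minorityN.
pose e : R := (1 / 2) ^+ (4 * m (B l.+1)).
have e0 : 0 < e by rewrite exprn_gt0 //; lra.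
have [L lL rL] := exists_small l e0.
pose D x := 1 / 2 * long_minority l L x + 1 / 2 * (3 / 4) ^+ L.
have r0 : 0 <= (3 / 4 : R) ^+ L by apply: exprn_ge0; lra.
have D0 x : 0 <= D x.
  have := long_minority_ge0  l L x; rewrite /D; lra.
have qD x : qY x <= drift_kernel x + D x.
  have := h_lower x lL; rewrite /qY /biased /drift_kernel /D; lra.
(* The window is cut at time 0, where all letters are +. *)
set N := minn n (m j).
have Nn : (N <= n)%N by exact: geq_minl.
rewrite -[X in iter X](subnK Nn) iterD.
apply: (@le_trans _ _ (iter (n - N) (transfer drift_kernel) (fun y =>
   iter N (transfer qY) f y + \sum_(0 <= t < N) iter t (transfer drift_kernel) D y) plus)).
  apply: iter_transfer_le => // y.
  exact: iter_transfer_compare.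
rewrite iter_transferD iter_transfer_sum.
(* Before time m j the comparison starts from the all-plus past, for which the
   probability of a minority increases with time. *)
have part1 : iter (n - N) (transfer drift_kernel) (iter N (transfer qY) f) plus
    <= (1 / 2) ^+ (j + 2).
  have [mn|nm] := leqP (m j) n.
    rewrite /N (minn_idPr mn) -[leRHS](iter_transfer_cst drift_kernel (n - m j) _ plus).
    by apply: iter_transfer_le => // y; exact: long_scale_deviation.
  rewrite /N (minn_idPl (ltnW nm)) subnn /=.
  apply: le_trans (long_scale_deviation plus l1 lj).
  have := iter_transfer_plus_decr kY fN (ltnW nm) mY.
  have neE k : iter k (transfer qY) (fun x => - f x) plus =
      - iter k (transfer qY) f plus.
    rewrite -mulN1r -iter_transferZ; congr (iter _ _ _ _).
    by apply/funext => x; rewrite mulN1r.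
  by rewrite !neE lerN2.
have part2 : \sum_(0 <= t < N) iter (n - N) (transfer drift_kernel)
    (iter t (transfer drift_kernel) D) plus <= (m j)%:R * e.
  apply: (@le_trans _ _ (\sum_(0 <= t < N) e)).
    apply: ler_sum_nat => t /andP[_ tN]; rewrite -iterD.
    have sn : (n - N + t < n)%N by lia.
    rewrite /D iter_transfer_lin iter_transfer_cst.
    have : iter (n - N + t) (transfer drift_kernel) (long_minority l L) plus <= e.
      apply: long_minority_iter => i j' li lij'.
      by apply: (ih _ sn i) => //; exact: leq_trans (ltnW li).
    lra.
  rewrite sumr_const_nat subn0 -[leLHS]mulr_natl.
  by apply: ler_wpM2r; [exact: ltW|rewrite ler_nat geq_minr].
have part3 : (m j)%:R * e <= (1 / 2) ^+ (j + 2).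
  have /andP[/andP[jB jB'] _] := lj.
  have j1 : (1 <= j)%N by exact: leq_ltn_trans jB.
  have mM : (m j <= m (B l.+1))%N by exact: m_mono.
  have jm := m_ge j1.
  apply: (@le_trans _ _ (2 ^+ m (B l.+1) * e)).
    apply: ler_wpM2r; first exact: ltW.
    by rewrite -natrX ler_nat (leq_trans mM) // ltnW // ltn_expl.
  rewrite /e; move: mM; set M := m (B l.+1) => mM; rewrite (_ : (4 * M = M + 3 * M)%N); last lia.
  rewrite exprD mulrA -exprMn (_ : 2 * (1 / 2) = 1 :> R); last lra.
  by rewrite expr1n [leLHS]mul1r; apply: ler_wiXn2l; [lra|lra|lia].
have : (1 / 2 : R) ^+ (j + 2) = 1 / 4 * (1 / 2) ^+ j by rewrite exprD; lra.
have : 0 <= (1 / 2 : R) ^+ j by apply: exprn_ge0; lra.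
move: part1 part2 part3; lra.
Qed.

(** The first block may be lost: it weighs less than the bias of the others. *)
Lemma drift_persistence n : 1 / 8 <= iter n (transfer drift_kernel) h plus.
Proof.
have kk := drift_kernel_is_kernel.
have [L L0 rL] := @exists_small (1 / 64) 0 ltac:(lra).
have B0 := block_end0.
apply: (@le_trans _ _ (iter n (transfer drift_kernel) (fun x => -2 * long_minority 0 L x
    + (w 0 - 2 * (3 / 4) ^+ L)) plus)); last first.
  apply: iter_transfer_le => // x; have := h_lower x L0.
  rewrite /field B0 big_geq //; lra.
rewrite iter_transfer_lin iter_transfer_cst.
have := @long_minority_iter n 0 L (fun i j li => long_scale_persistence n li).
rewrite block_end1 => lm.
have m1 := m_ge (leqnn 1).
have : (1 / 2 : R) ^+ (4 * m 1%N) <= (1 / 2) ^+ 5.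
  apply: ler_wiXn2l; [lra|lra|lia].
rewrite /w expr0; lra.
Qed.

End persistence.

(** * The Bramson-Kalikow kernel *)

Local Notation BK := (BK_model (1 / 4 : R) lam m).

Lemma BK_majority_concat k a x : odd k ->
  BK_majority (1 / 4 : R) k (concat a x) =
  1 / 2 + (if a then 1 else -1) * majority R k x / 4.
Proof.
move=> ok; rewrite /BK_majority big_add1 /= -/(block_sum k x).
have := block_sum_odd_neq0 x ok; rewrite /majority /minority /spin.
by case: a; rewrite ?mul1r ?mulN1r ?oppr_gt0 ?oppr_lt0; case: ltrgtP => //= _ _; lra.
Qed.

Lemma concat_Tshift x : concat (x 0%N) (Tshift x) = x.
Proof. by apply/funext => -[]. Qed.

Lemma BK_majority_bound k x : odd k -> 1 / 4 <= BK_majority (1 / 4 : R) k x <= 3 / 4.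
Proof.
move=> ok; rewrite -(concat_Tshift x) BK_majority_concat //.
by have := majority_bound R k (Tshift x); case: (x 0%N); lra.
Qed.

Definition BK_partial n x : R := \sum_(1 <= j < n.+1) lam j * BK_majority (1 / 4) (m j) x.

(** All majority terms lie between 1/4 and 3/4, so a tail of the series is known
    up to a quarter of its weight on either side of one half. *)
Lemma BK_partial_block L L' x : (L <= L')%N ->
  1 / 4 * ((3 / 4) ^+ L - (3 / 4) ^+ L') <= BK_partial (B L') x - BK_partial (B L) x
  <= 3 / 4 * ((3 / 4) ^+ L - (3 / 4) ^+ L').
Proof.
move=> LL.
have -> : (3 / 4) ^+ L - (3 / 4) ^+ L' = \sum_((B L).+1 <= j < (B L').+1) lam j.
  rewrite sum_blocks // -sum_block_weight //.
  by apply: eq_bigr => i _; rewrite sum_lam_block.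
rewrite /BK_partial (@big_cat_nat _ _ _ (B L).+1 1 (B L').+1) //=; last first.
  by rewrite ltnS block_end_mono.
rewrite addrAC subrr add0r !mulr_sumr; apply/andP; split.
  apply: ler_sum_nat => j /andP[j1 _]; rewrite mulrC.
  have j0 : (1 <= j)%N by exact: leq_ltn_trans j1.
  apply: ler_wpM2l; first exact: lam_ge0.
  by have /andP[] := BK_majority_bound x (m_odd j0).
apply: ler_sum_nat => j /andP[j1 _]; rewrite [leRHS]mulrC.
have j0 : (1 <= j)%N by exact: leq_ltn_trans j1.
apply: ler_wpM2l; first exact: lam_ge0.
by have /andP[] := BK_majority_bound x (m_odd j0).
Qed.

Lemma BK_partial_nondecr x : nondecreasing_seq (BK_partial ^~ x).
Proof.
apply/nondecreasing_seqP => n; rewrite /BK_partial [leRHS]big_nat_recr //=.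
rewrite lerDl mulr_ge0 ?lam_ge0 //.
have := BK_majority_bound x (m_odd (isT : (1 <= n.+1)%N)); lra.
Qed.

Lemma BK_partial_le L n x : BK_partial n x <= BK_partial (B L) x + 3 / 4 * (3 / 4) ^+ L.
Proof.
have nB : (n <= B (maxn n L))%N.
  by apply: leq_trans (block_end_ge _); exact: leq_maxl.
apply: le_trans (BK_partial_nondecr x nB) _.
have /andP[_] := BK_partial_block x (leq_maxr n L).
have : 0 <= (3 / 4 : R) ^+ maxn n L by apply: exprn_ge0; lra.
lra.
Qed.

Lemma BK_cvg x : cvg (BK_partial ^~ x @ \oo).
Proof.
apply: nondecreasing_is_cvgn; first exact: BK_partial_nondecr.
by exists (BK_partial (B 0) x + 3 / 4 * (3 / 4) ^+ 0) => _ [n _ <-]; exact: BK_partial_le.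
Qed.

Lemma BK_approx L x :
  BK_partial (B L) x + 1 / 4 * (3 / 4) ^+ L <= BK x
  <= BK_partial (B L) x + 3 / 4 * (3 / 4) ^+ L.
Proof.
apply/andP; split; last first.
  by apply: limr_le; [exact: BK_cvg|near=> n; exact: BK_partial_le].
apply/ler_addgt0Pl => e e0; have [L' LL' L'e] := exists_small L e0.
have : BK_partial (B L') x <= BK x.
  exact: (nondecreasing_cvgn_le (@BK_partial_nondecr x) (@BK_cvg x)).
have /andP[+ _] := BK_partial_block x (ltnW LL').
lra.
Unshelve. all: by end_near. Qed.

Lemma BK_partial_concat n a x : BK_partial n (concat a x) =
  1 / 2 * (\sum_(1 <= j < n.+1) lam j) + (if a then 1 else -1) * field n x / 4.
Proof.
rewrite /BK_partial /field !mulr_sumr mulr_suml -big_split /=.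
apply: eq_big_nat => j /andP[j1 _].
by rewrite BK_majority_concat ?m_odd //; case: (a); field.
Qed.

Lemma eq_small_pow (x : R) : (forall L, `|x| <= (3 / 4) ^+ L) -> x = 0.
Proof.
move=> xL; apply/eqP; rewrite -normr_le0; apply/ler_addgt0Pl => e e0.
have [L _ Le] := exists_small 0 e0.
by rewrite addr0; apply: le_trans (xL L) Le.
Qed.

Lemma BK_sum x : BK (concat true x) + BK (concat false x) = 1.
Proof.
apply/eqP; rewrite -subr_eq0; apply/eqP/eq_small_pow => L.
have /andP[a1 a2] := BK_approx L (concat true x).
have /andP[b1' b2] := BK_approx L (concat false x).
move: a1 a2 b1' b2; rewrite !BK_partial_concat sum_lam.
have : 0 <= (3 / 4 : R) ^+ L by apply: exprn_ge0; lra.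
rewrite ler_norml => r0 a1 a2 b1' b2; apply/andP; split; lra.
Qed.

Lemma BK_bound x : 1 / 4 <= BK x <= 3 / 4.
Proof.
have := BK_approx 0 x; rewrite block_end0 /BK_partial big_geq // expr0; lra.
Qed.

Lemma BK_flip x : BK (flip x) = BK x.
Proof.
congr (lim (_ @ \oo)); apply/funext => n; apply: eq_big_nat => j /andP[j1 _].
congr (_ * _); rewrite -(concat_Tshift x) flip_concat !BK_majority_concat ?m_odd //.
by rewrite majority_flip ?m_odd //; case: (x 0%N) => /=; ring.
Qed.

Lemma BK_uniform : prefix_uniform BK.
Proof.
move=> e e0; have [L _ Le] := exists_small 0 e0.
exists (m (B L)).+1 => x y xy.
have E : BK_partial (B L) x = BK_partial (B L) y.
  rewrite -(concat_Tshift x) -(concat_Tshift y) xy // !BK_partial_concat.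
  have ML j : (1 <= j <= B L)%N -> (m j <= m (B L))%N.
    by move=> /andP[j1 jB]; exact: m_mono.
  by rewrite (memory_field lam ML (y := Tshift y)) // => i iM; exact: xy.
have /andP[a1 a2] := BK_approx L x; have /andP[b1' b2] := BK_approx L y.
move: a1 a2; rewrite E ler_norml => a1 a2.
have : 0 <= (3 / 4 : R) ^+ L by apply: exprn_ge0; lra.
move=> r0; apply/andP; split; lra.
Qed.

Lemma BK_gfunction : gfunction BK.
Proof.
split; first exact: (continuous_prefix BK_uniform).
  by move=> x; have := BK_bound x; lra.
by move=> x; rewrite big_bool /= BK_sum.
Qed.

Definition drift x : R := 4 * BK (concat true x) - 2.

Lemma drift_field L x : `|drift x - field (B L) x| <= (3 / 4) ^+ L.
Proof.
have /andP[] := BK_approx L (concat true x).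
rewrite BK_partial_concat sum_lam /drift ler_norml => h1 h2.
apply/andP; split; lra.
Qed.

Lemma drift_kernelE : drift_kernel drift = (fun x => BK (concat true x)).
Proof. by apply/funext => x; rewrite /drift_kernel /drift; lra. Qed.

(** In the stationary mean started from the all-plus past the letter at 0 is +
    with probability 1/2 plus a quarter of the mean drift, at least 17/32.  The
    kernel is invariant under the flip, so the flipped mean is stationary too,
    and there this probability is at most 15/32. *)
Lemma two_gmeasures : exists mu1 mu2 : probability config R,
  [/\ gmeasure BK mu1, gmeasure BK mu2
    & exists2 A : set config, measurable A & mu1 A <> mu2 A].
Proof.
pose q x := BK (concat true x).
have kq : is_kernel q by move=> x; have := BK_bound (concat true x); rewrite /q; lra.
have qF x : q (flip x) = 1 - q x.
  have -> : q (flip x) = BK (concat false x).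
    by rewrite /q -(BK_flip (concat false x)) flip_concat.
  by have := BK_sum x; rewrite /q; lra.
have [Lam [lin L1 stat low]] := exists_stationary_mean plus kq.
have Lge0 f : bounded_obs f -> (forall x, 0 <= f x) -> 0 <= Lam f.
  move=> bf f0; apply: low => // n.
  rewrite -[leLHS](iter_transfer_cst q n 0 plus); exact: iter_transfer_le.
have bflip f : bounded_obs f -> bounded_obs (f \o flip).
  by move=> [C fC]; exists C => x; exact: fC.
pose Lam' f := Lam (f \o flip).
have lin' f h a : bounded_obs f -> bounded_obs h ->
    Lam' (fun x => a * f x + h x) = a * Lam' f + Lam' h.
  by move=> bf bh; apply: (lin (f \o flip) (h \o flip)); exact: bflip.
have L1' : Lam' (fun=> 1) = 1 by exact: L1.
have stat' f : bounded_obs f -> Lam' (transfer q f) = Lam' f.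
  move=> bf; rewrite /Lam' -[RHS]stat; last exact: bflip.
  congr Lam; apply/funext => x /=.
  exact: (iter_transfer_flip 1 f qF).
have Lge0' f : bounded_obs f -> (forall x, 0 <= f x) -> 0 <= Lam' f.
  by move=> bf f0; apply: Lge0; [exact: bflip|move=> x; exact: f0].
have [mu1 mu1E] := exists_mean_measure lin Lge0 L1.
have [mu2 mu2E] := exists_mean_measure lin' Lge0' L1'.
exists mu1, mu2; split.
- exact: (mean_measure_gmeasure BK_gfunction BK_uniform lin Lge0 L1 stat mu1E).
- exact: (mean_measure_gmeasure BK_gfunction BK_uniform lin' Lge0' L1' stat' mu2E).
exists (cylinder [:: true]); first exact: measurable_cylinder.
rewrite mu1E mu2E => -[].
have Eq : Lam (ind R [:: true]) = Lam q.
  rewrite -stat; last exact: bounded_ind.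
  congr Lam; apply/funext => x; rewrite /transfer /ind /=; ring.
have bq : bounded_obs q.
  by exists 1 => x; have := kq x; rewrite ler_norml; lra.
have q1 : 17 / 32 <= Lam q.
  apply: low => // n.
  have := drift_persistence drift_field n; rewrite drift_kernelE.
  have -> : iter n (transfer q) q plus =
      1 / 4 * iter n (transfer q) drift plus + 1 / 2.
    rewrite -(iter_transfer_cst q n (1 / 2) plus) -iter_transfer_lin.
    congr (iter _ _ _ _); apply/funext => x; rewrite /q /drift; lra.
  rewrite -/q; lra.
have Ef : Lam' (ind R [:: true]) = 1 - Lam q.
  have -> : 1 - Lam q = -1 * Lam (ind R [:: true]) + Lam (fun=> 1).
    by rewrite L1 Eq; ring.
  rewrite -lin; [|exact: bounded_ind|by exists 1 => x; rewrite normr1].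
  congr Lam; apply/funext => x; rewrite /ind /= /flip.
  by case: (x 0%N) => /=; ring.
rewrite Eq Ef; lra.
Qed.

End scales.

Theorem corollary2 (R : realType) (c : R) (m b : nat -> nat) (lam : nat -> R)
    (c_ge8 : 8 <= c)
    (m_odd : forall j : nat, (1 <= j)%N -> odd (m j))
    (m_def : forall j : nat, (1 <= j)%N ->
       (m j)%:R = 2 `^ (c * j%:R ^+ 2) - 1 :> R)
    (b1 : b 1%N = 1%N)
    (b_def : forall l : nat, (2 <= l)%N ->
       (b l)%:R = 2 `^ ((c * \sum_(1 <= j < l) (b j)%:R) ^+ 2) :> R)
    (lam_def : forall l j : nat, (1 <= l)%N ->
       (\sum_(1 <= k < l) b k + 1 <= j <= \sum_(1 <= k < l.+1) b k)%N ->
       lam j = (3 / 4) ^+ (l - 1)%N / (4 * (b l)%:R)) :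
  exists mu1 mu2 : probability config R,
    [/\ gmeasure (BK_model (1 / 4) lam m) mu1,
        gmeasure (BK_model (1 / 4) lam m) mu2
      & exists2 B : set config, measurable B & mu1 B <> mu2 B].
Proof. exact: (two_gmeasures c_ge8 m_odd m_def b1 b_def lam_def). Qed.
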